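(* Let $q$ be a prime power, $n\ge 1$, $k\geq 1$, and for $i=1,\dots,k$ let $L_i=\mathrm{GL}_{m_{i,1}}(\mathbb{F}_q)\times\cdots\times \mathrm{GL}_{m_{i,s_i}}(\mathbb{F}_q)\subseteq \mathrm{GL}_n(\mathbb{F}_q)$ be a block diagonal Levi subgroup, with $m_{i,1}+\cdots+m_{i,s_i}=n$, and let $\delta_i:L_i\to\mathbb{C}^*$ be the linear character $\delta_i(M_1,\dots,M_{s_i})=\prod_{j=1}^{s_i}\delta_{i,j}(\det M_j)$ with $\delta_{i,j}\in\mathrm{Hom}(\mathbb{F}_q^*,\mathbb{C}^* )$. Let $Q=(I,\Omega)$ and $\alpha\in\mathbb{N}^I$ be the associated star-shaped quiver and dimension vector. Let $V\subseteq(\mathbb{N}^I)^*$ and suppose that the $k$-tuple $\mathcal{X}=(R^G_{L_1}(\delta_1),\dots,R^G_{L_k}(\delta_k))$ is of level $V$. Then $$\langle R^G_{L_1}(\delta_1)\otimes\cdots\otimes R^G_{L_k}(\delta_k),1\rangle=M_{Q,\alpha,V}(q).$$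
   Context: $R^G_{L}(\gamma)$ denotes the Harish-Chandra induced character of $\mathrm{GL}_n(\mathbb{F}_q)$: inflate the linear character $\gamma$ of $L$ to the block upper triangular parabolic subgroup $P$ with Levi factor $L$ via $P\to L$, and induce to $\mathrm{GL}_n(\mathbb{F}_q)$. It is not assumed irreducible. For characters $\chi,\psi$ of a finite group $H$, $\langle\chi,\psi\rangle=\frac1{|H|}\sum_{h\in H}\chi(h)\overline{\psi(h)}$. Star-shaped quiver $Q=(I,\Omega)$: vertices $0$ and $[i,j]$ for $1\le i\le k$, $1\le j\le s_i-1$; arrows $[i,1]\to 0$ and $[i,j+1]\to[i,j]$. (Write $[i,0]=0$.) The dimension vector $\alpha\in\mathbb{N}^I$ is $\alpha_0=n$, $\alpha_{[i,j]}=n-\sum_{h=1}^{j}m_{i,h}$. $(\mathbb{N}^I)^*\subseteq\mathbb{N}^I$ is the set of vectors $\beta$ that are non-increasing along the legs: $\beta_{[i,j]}\ge\beta_{[i,j+1]}$ for all $i$ and $j\geq 0$. Vectors are ordered componentwise. Level of a $k$-tuple: define $\sigma_{\mathcal{X}}\in\mathrm{Hom}(\mathbb{F}_q^*,\mathbb{C}^* )^I$ by $(\sigma_{\mathcal X})_0=\prod_{i=1}^k\delta_{i,1}$ and $(\sigma_{\mathcal X})_{[i,j]}=\delta_{i,j+1}\delta_{i,j}^{-1}$ for $1\le j\le s_i-1$. For $\beta\in\mathbb{N}^I$ put $\sigma_{\mathcal X}^\beta=\prod_{v\in I}(\sigma_{\mathcal X})_v^{\beta_v}$. Let $\mathcal{H}^*_{\sigma_{\mathcal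 X},\alpha}=\{\beta\in(\mathbb{N}^I)^*\mid 0<\beta\le\alpha,\ \sigma_{\mathcal X}^\beta=1\}$. The $k$-tuple $\mathcal{X}$ is of level $V$ if $\mathcal{H}^*_{\sigma_{\mathcal X},\alpha}=\{\beta\in V\mid 0<\beta\le\alpha\}$. Representations of level at most $V$: for a finite-dimensional representation $M$ of $Q$ over $\mathbb{F}_q$, let $\mathcal{H}_M$ be the set of dimension vectors of the indecomposable direct summands of $M\otimes_{\mathbb{F}_q}\overline{\mathbb{F}}_q$ (in its Krull-Schmidt decomposition). $M$ is of level at most $V$ if $\mathcal{H}_M\subseteq V$. There is a unique polynomial $M_{Q,\alpha,V}(t)\in\mathbb{Z}[t]$ such that for every prime power $q$, $M_{Q,\alpha,V}(q)$ is the number of isomorphism classes of representations of $Q$ over $\mathbb{F}_q$ of dimension vector $\alpha$ and of level at most $V$. *)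

(* Defs.v *)
From HB Require Import structures.
From mathcomp Require Import all_boot all_order all_algebra.
From mathcomp Require Import all_fingroup all_solvable all_field all_character.
From mathcomp Require Import boolp.

Set Implicit Arguments.
Unset Strict Implicit.
Unset Printing Implicit Defensive.

Import GroupScope GRing.Theory Num.Theory.
Local Open Scope ring_scope.

(* The (i, j) block of an N x N matrix with respect to a composition of N.
   The parts [m j] may be 0 (the corresponding factor GL_0 is trivial). *)
Definition blk s (m : 'I_s -> nat) N (e : (\sum_j m j = N)%N) (R : Type)
    (A : 'M[R]_N) (i j : 'I_s) : 'M[R]_(m i, m j) :=
  submxblock (castmx (esym e, esym e) A) i j.

Lemma blkP s (m : 'I_s -> nat) N (e : (\sum_j m j = N)%N) (R : Type)
    (A B : 'M[R]_N) : (forall i j, blk e A i j = blk e B i j) -> A = B.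
Proof. by case: N / e A B => A B; rewrite /blk !castmx_id => /mxblockP. Qed.

Lemma blkM s (m : 'I_s -> nat) N (e : (\sum_j m j = N)%N) (R : pzSemiRingType)
    (A B : 'M[R]_N) i j :
  blk e (A *m B) i j = \sum_l blk e A i l *m blk e B l j.
Proof.
case: N / e A B => A B; rewrite /blk !castmx_id.
by rewrite -{1}[A]submxblockK -{1}[B]submxblockK mul_mxblock mxblockK.
Qed.

Lemma blk1 s (m : 'I_s -> nat) N (e : (\sum_j m j = N)%N) (R : pzSemiRingType)
    i : blk e (1%:M : 'M[R]_N) i i = 1%:M.
Proof. by case: N / e; rewrite /blk !castmx_id -mxdiagZ submxblock_diag. Qed.

Lemma blk1_neq s (m : 'I_s -> nat) N (e : (\sum_j m j = N)%N)
    (R : pzSemiRingType) i j : i != j -> blk e (1%:M : 'M[R]_N) i j = 0.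
Proof.
by case: N / e => /negPf ij; rewrite /blk !castmx_id -mxdiagZ mxblockK ij.
Qed.

Section HarishChandra.

Variables (F : finFieldType) (n s : nat) (m : 'I_s -> nat).
Hypothesis e : (\sum_j m j = n.+1)%N.

Local Notation gT := {'GL_n.+1[F]}.
Local Notation B g := (blk e (GLval g)).

Definition parabolic_set : {set gT} :=
  [set g : gT | [forall i : 'I_s, forall j : 'I_s, (j < i)%N ==> (B g i j == 0)]].

Definition levi_set : {set gT} :=
  [set g : gT | [forall i : 'I_s, forall j : 'I_s, (i != j) ==> (B g i j == 0)]].

Definition unipotent_radical_set : {set gT} :=
  [set g in parabolic_set | [forall j, B g j j == 1%:M]].

Lemma parabolicP (g : gT) :
  reflect (forall i j : 'I_s, (j < i)%N -> B g i j = 0) (g \in parabolic_set).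
Proof.
rewrite inE; apply: (iffP 'forall_'forall_implyP) => H i j ij.
  exact/eqP/H.
exact/eqP/H.
Qed.

Lemma leviP (g : gT) :
  reflect (forall i j : 'I_s, i != j -> B g i j = 0) (g \in levi_set).
Proof.
rewrite inE; apply: (iffP 'forall_'forall_implyP) => H i j ij.
  exact/eqP/H.
exact/eqP/H.
Qed.

Lemma unipotentP (g : gT) :
  reflect (g \in parabolic_set /\ forall j, B g j j = 1%:M)
    (g \in unipotent_radical_set).
Proof.
rewrite [X in reflect _ X]inE; apply: (iffP andP) => -[Pg H]; split=> //.
  by move=> j; apply/eqP/(forallP H).
by apply/forallP=> j; apply/eqP; apply: H.
Qed.

Lemma levi_sub_parabolic : levi_set \subset parabolic_set.
Proof.
apply/subsetP=> g /leviP Lg; apply/parabolicP=> i j ij; apply: Lg.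
by rewrite eq_sym; apply: contraTneq ij => ->; rewrite ltnn.
Qed.

Lemma blk_GLM (g h : gT) i j : B (g * h)%g i j = \sum_l B g i l *m B h l j.
Proof. exact: blkM. Qed.

Lemma parabolic_blkM (g h : gT) j :
  g \in parabolic_set -> h \in parabolic_set ->
  B (g * h)%g j j = B g j j *m B h j j.
Proof.
move=> /parabolicP Pg /parabolicP Ph; rewrite blk_GLM (bigD1 j) //=.
rewrite big1 ?addr0 // => l; rewrite -val_eqE neq_ltn => /orP[] lj.
  by rewrite Pg ?mul0mx.
by rewrite Ph ?mulmx0.
Qed.

Lemma parabolic_group_set : group_set parabolic_set.
Proof.
apply/group_setP; split=> [|g h /parabolicP Pg /parabolicP Ph].
  apply/parabolicP=> i j ij; apply: blk1_neq.
  by rewrite -val_eqE neq_ltn ij orbT.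
apply/parabolicP=> i j ij; rewrite blk_GLM big1 // => l _.
have [li|il] := ltnP l i; first by rewrite Pg ?mul0mx.
by rewrite Ph ?mulmx0 ?(leq_trans ij il).
Qed.
Canonical parabolic : {group gT} := group parabolic_group_set.

Lemma levi_group_set : group_set levi_set.
Proof.
apply/group_setP; split=> [|g h /leviP Lg /leviP Lh].
  by apply/leviP=> i j ij; apply: blk1_neq.
apply/leviP=> i j ij; rewrite blk_GLM big1 // => l _.
have [<-|li] := eqVneq i l; first by rewrite Lh ?mulmx0.
by rewrite Lg ?mul0mx.
Qed.
Canonical levi : {group gT} := group levi_group_set.

Lemma unipotent_radical_group_set : group_set unipotent_radical_set.
Proof.
apply/group_setP; split=> [|g h /unipotentP[Pg Ug] /unipotentP[Ph Uh]].
  by apply/unipotentP; split=> [|j]; [exact: (group1 parabolic) | exact: blk1].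
apply/unipotentP; split=> [|j]; first exact: (groupM (G := parabolic)).
by rewrite parabolic_blkM // Ug Uh mulmx1.
Qed.
Canonical unipotent_radical : {group gT} := group unipotent_radical_group_set.

Lemma levi_part (g : gT) : g \in parabolic ->
  exists2 l, l \in levi & forall j, B l j j = B g j j.
Proof.
move=> Pg; have Pg1 : g^-1%g \in parabolic by rewrite groupV.
pose D (h : gT) : 'M[F]_n.+1 := castmx (e, e) (\mxdiag_j B h j j).
have DE (h : gT) i j :
    blk e (D h) i j = if i == j then conform_mx 0 (B h i i) else 0.
  by rewrite /blk /D castmx_comp castmx_id mxblockK.
have DM : D g *m D g^-1%g = 1%:M.
  apply: (@blkP _ _ _ e) => i j; rewrite blkM.
  under eq_bigr => l _ do rewrite !DE.
  have [->{i}|ij] := eqVneq i j.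
    have gV : B g j j *m B g^-1%g j j = 1%:M.
      by rewrite -parabolic_blkM // mulgV; apply: blk1.
    rewrite blk1 -[RHS]gV (bigD1 j) // eqxx !conform_mx_id big1 ?[LHS]addr0 //.
    by move=> l /negPf lj; rewrite eq_sym lj mul0mx.
  rewrite blk1_neq // big1 // => l _; have [il|] := eqVneq i l.
    by rewrite -il (negPf ij) mulmx0.
  by rewrite mul0mx.
have Dunit : D g \in unitmx by case: (mulmx1_unit DM).
exists (FinRing.unit 'M_n.+1 Dunit) => [|j].
  by apply/leviP=> i j ij; rewrite [LHS]DE (negPf ij).
by rewrite [LHS]DE eqxx conform_mx_id.
Qed.

Lemma parabolic_sdprod : unipotent_radical ><| levi = parabolic.
Proof.
have sUP : unipotent_radical \subset parabolic.
  by apply/subsetP=> g /unipotentP[].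
have nUP : parabolic \subset 'N(unipotent_radical).
  apply/subsetP=> x Px; rewrite inE; apply/subsetP=> _ /imsetP[u Uu ->].
  have /unipotentP[Pu U1] := Uu.
  apply/unipotentP; split=> [|j]; first by rewrite groupJ.
  rewrite !parabolic_blkM ?groupM ?groupV // U1 mul1mx.
  by rewrite -parabolic_blkM ?groupV // mulVg; apply: blk1.
have tiUL : unipotent_radical :&: levi = 1%g.
  apply/trivgP/subsetP=> g /setIP[/unipotentP[_ U1] /leviP L0].
  rewrite inE; apply/eqP/val_inj/(@blkP _ _ _ e) => i j.
  by have [->|ij] := eqVneq i j; rewrite ?[LHS]U1 ?[LHS]L0 ?blk1 ?blk1_neq.
rewrite sdprodE //; last exact: subset_trans levi_sub_parabolic nUP.
apply/eqP; rewrite eqEsubset mul_subG ?levi_sub_parabolic //=.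
apply/subsetP=> g Pg; have [l Ll lE] := levi_part Pg.
have Pl : l \in parabolic := subsetP levi_sub_parabolic l Ll.
rewrite -(mulgKV l g); apply/mulsgP; exists (g * l^-1)%g l => //.
apply/unipotentP; split=> [|j]; first by rewrite groupM ?groupV.
rewrite parabolic_blkM ?groupV // -lE -parabolic_blkM ?groupV //.
by rewrite mulgV; apply: blk1.
Qed.

(* Inflation along P -> P / U = L, followed by induction. *)
Definition HC_ind (gamma : 'CF(levi)) : 'CF('GL_n.+1[F]) :=
  'Ind['GL_n.+1[F]] (cfSdprod parabolic_sdprod gamma).

(* The determinant of the j-th factor, as an element of F^*; the default
   value of [insubd] is never used on [levi]. *)
Definition levi_det (j : 'I_s) (g : gT) : {unit F} :=
  insubd (1%g : {unit F}) (\det (B g j j)).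

Lemma levi_detE j : {in levi, forall g, val (levi_det j g) = \det (B g j j)}.
Proof.
move=> g Lg; rewrite /levi_det insubdK //.
have Pg : g \in parabolic := subsetP levi_sub_parabolic g Lg.
have : B g j j *m B g^-1%g j j = 1%:M.
  by rewrite -parabolic_blkM ?groupV // mulgV; apply: blk1.
by case/mulmx1_unit; rewrite unitmxE.
Qed.

Lemma levi_detM j : {in levi &, {morph levi_det j : g h / (g * h)%g}}.
Proof.
move=> g h Lg Lh; apply: val_inj; rewrite /= !levi_detE ?groupM //.
by rewrite parabolic_blkM ?(subsetP levi_sub_parabolic) // det_mulmx.
Qed.
Canonical levi_det_morphism j := Morphism (@levi_detM j).

Definition levi_char (delta : 'I_s -> 'CF([set: {unit F}])) : 'CF(levi) :=
  \prod_j cfMorph ('Res[levi_det j @* levi] (delta j)).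

Lemma levi_charE delta : {in levi, forall g,
  levi_char delta g = \prod_j delta j (levi_det j g)}.
Proof.
move=> g Lg; rewrite /levi_char; elim/big_rec2: _ => [|j x phi _ IH].
  by rewrite cfun1E Lg.
rewrite cfunE IH cfMorphE // cfResE ?subsetT //.
exact: mem_morphim.
Qed.

Lemma levi_char_lin delta :
  (forall j, delta j \is a linear_char) -> levi_char delta \is a linear_char.
Proof.
move=> lin_delta; apply: rpred_prod => j _.
by apply/cfMorph_lin_char/cfRes_lin_char.
Qed.

End HarishChandra.

Record quiver := Quiver {
  vertex : finType;
  arrow : finType;
  source : arrow -> vertex;
  target : arrow -> vertex
}.

Section Quiver.

Variable Q : quiver.

Definition dimvec := vertex Q -> nat.

Definition dimvec_le (b d : dimvec) : Prop := forall v, (b v <= d v)%N.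

Definition dimvec_pos (b : dimvec) : Prop := exists v, (0 < b v)%N.

(* Row-vector convention: the arrow a acts by x |-> x *m M a. *)
Definition rep (K : fieldType) (d : dimvec) : Type :=
  forall a : arrow Q, 'M[K]_(d (source a), d (target a)).

(* The two dimension vectors need only be provably equal, which avoids casts
   when the target is a direct sum. *)
Definition rep_iso (K : fieldType) (d d' : dimvec) (M : rep K d) (N : rep K d')
    : Prop :=
  exists (g : forall v, 'M[K]_(d v, d' v)) (h : forall v, 'M[K]_(d' v, d v)),
    (forall v, g v *m h v = 1%:M /\ h v *m g v = 1%:M) /\
    (forall a, M a *m g (target a) = g (source a) *m N a).

Definition rep_dsum (K : fieldType) (d1 d2 : dimvec)
    (M1 : rep K d1) (M2 : rep K d2) : rep K (fun v => d1 v + d2 v)%N :=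
  fun a => block_mx (M1 a) 0 0 (M2 a).

Definition indecomposable (K : fieldType) (d : dimvec) (M : rep K d) : Prop :=
  dimvec_pos d /\
  forall (d1 d2 : dimvec) (M1 : rep K d1) (M2 : rep K d2),
    rep_iso M (rep_dsum M1 M2) -> ~ (dimvec_pos d1 /\ dimvec_pos d2).

Definition alg_closure (F : finFieldType) : countClosedFieldType :=
  tag (countable_algebraic_closure F).

Definition to_alg_closure (F : finFieldType) : {rmorphism F -> alg_closure F} :=
  sval (tagged (countable_algebraic_closure F)).

Definition geom_ext (F : finFieldType) (d : dimvec) (M : rep F d) :
    rep (alg_closure F) d :=
  fun a => map_mx (to_alg_closure F) (M a).

(* By Krull-Schmidt these are the dimension vectors occurring in any
   decomposition of the scalar extension of M into indecomposables. *)
Definition summand_dims (F : finFieldType) (d : dimvec) (M : rep F d)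
    (b : dimvec) : Prop :=
  exists (N : rep (alg_closure F) b) (c : dimvec) (N' : rep (alg_closure F) c),
    indecomposable N /\ rep_iso (geom_ext M) (rep_dsum N N').

Definition level_at_most (V : dimvec -> Prop) (F : finFieldType) (d : dimvec)
    (M : rep F d) : Prop :=
  forall b, summand_dims M b -> V b.

(* Finite functions replace [rep F d], which is not a finType, for counting. *)
Definition num_iso_classes (V : dimvec -> Prop) (F : finFieldType) (d : dimvec)
    : nat :=
  #|equivalence_partition
      (fun M N : {dffun forall a : arrow Q, 'M[F]_(d (source a), d (target a))}
         => `[< rep_iso (M : rep F d) (N : rep F d) >])
      [set M : {dffun forall a : arrow Q, 'M[F]_(d (source a), d (target a))}
         | `[< level_at_most V (M : rep F d) >]]|.

(* The characterization of M_{Q,d,V}(t). Finite fields of every prime power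
   order exist, so at most one polynomial satisfies it. *)
Definition is_level_poly (d : dimvec) (V : dimvec -> Prop) (M : {poly int})
    : Prop :=
  forall F : finFieldType, M.[#|F|%:Z] = (num_iso_classes V F d)%:Z.

End Quiver.

(* The i-th leg has [l i] vertices, so that s_i = (l i).+1. The central vertex 0
   is [None], and [i, j] is [Some (Tagged _ j')] with j' = j - 1 : 'I_(l i). *)
Definition leg_vertex (k : nat) (l : 'I_k -> nat) : finType :=
  {i : 'I_k & 'I_(l i)}.

(* [i, j] |-> [i, j - 1], where [i, 0] = 0. *)
Definition leg_pred (k : nat) (l : 'I_k -> nat) (x : leg_vertex l) :
    option (leg_vertex l) :=
  let j := tagged x in
  if (j == 0 :> nat) then None
  else Some (Tagged (fun i => 'I_(l i))
               (Ordinal (leq_ltn_trans (leq_pred j) (ltn_ord j)))).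

(* Each leg vertex is the source of exactly one arrow. *)
Definition star (k : nat) (l : 'I_k -> nat) : quiver :=
  {| vertex := option (leg_vertex l);
     arrow := leg_vertex l;
     source := Some;
     target := @leg_pred k l |}.

Section Star.

Variables (k : nat) (l : 'I_k -> nat).

Definition nonincreasing (b : dimvec (star l)) : Prop :=
  forall x : leg_vertex l, (b (Some x) <= b (leg_pred x))%N.

Definition star_dim (n : nat) (m : forall i : 'I_k, 'I_(l i).+1 -> nat) :
    dimvec (star l) :=
  fun v => if v is Some x
           then (n - \sum_(h < (l (tag x)).+1 | (h <= tagged x)%N) m (tag x) h)%N
           else n.

Variables (F : finFieldType)
  (delta : forall i : 'I_k, 'I_(l i).+1 -> 'CF([set: {unit F}])).

(* [lift ord0] and [widen_ord] are j' |-> j' + 1 and j' |-> j' from 'I_(l i)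
   to 'I_(l i).+1. *)
Definition sigma (v : vertex (star l)) : 'CF([set: {unit F}]) :=
  if v is Some x
  then (delta (lift ord0 (tagged x))
        / delta (widen_ord (leqnSn _) (tagged x)))%R
  else (\prod_i delta (ord0 : 'I_(l i).+1))%R.

Definition sigma_pow (b : dimvec (star l)) : 'CF([set: {unit F}]) :=
  \prod_v sigma v ^+ b v.

Definition Hstar (a b : dimvec (star l)) : Prop :=
  [/\ nonincreasing b, dimvec_pos b, dimvec_le b a & sigma_pow b = 1].

Definition is_of_level (a : dimvec (star l)) (V : dimvec (star l) -> Prop)
    : Prop :=
  forall b, Hstar a b <-> [/\ V b, dimvec_pos b & dimvec_le b a].

End Star.

(* Main.v *)
Require Import Defs.
From HB Require Import structures.
From mathcomp Require Import all_boot all_order all_algebra.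
From mathcomp Require Import all_fingroup all_solvable all_field all_character.
From mathcomp Require Import boolp zify.

(* By Mackey's formula the multiplicity counts the GL_n-orbits of k-tuples of
   flags on whose stabilizer the product of the characters delta_i is trivial.
   A k-tuple of flags is a representation M of the star quiver of dimension
   alpha with injective maps, its stabilizer is Aut M, and the character is
   g |-> prod_v sigma_v (det g_v).  It remains to see that, when M is injective,
   this character is trivial on Aut M if and only if sigma^b = 1 for the
   dimension vector b of every direct summand of M over the algebraic closure.

   If all sigma^b are 1, then so is the value at g: det g_v is the product of
   the eigenvalues z with multiplicities the dimensions of the generalized
   eigenspaces, which are direct summands, and Frobenius permutes the z.
   Conversely, a summand N is defined over a finite extension K of F; its
   restriction of scalars X is a summand of a power of M, and an element x of
   K^* acts on X with determinants norm(x)^(b v).  So it suffices that triviality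
   of the character passes from Aut M to Aut X: this is Gaussian elimination
   over the local endomorphism rings of indecomposables. *)

Set Implicit Arguments.
Unset Strict Implicit.
Unset Printing Implicit Defensive.

Import GroupScope GRing.Theory Num.Theory.
Local Open Scope ring_scope.

(** Level at most V forces injectivity: the kernels of the maps to the central vertex split off as a
    direct summand whose dimension there is 0, and a dimension vector that is non-increasing along
    the legs and vanishes at the central vertex is 0.

    The characters take values in C, while the eigenvalues of an automorphism lie in the closure of
    F. A generator w of F^* links the two: writing sigma_v(w) = zeta^(e_v) with zeta of order q-1,
    the condition sigma^b = 1 says that q-1 divides the sum of the e_v b_v, and triviality at g
    becomes the equation prod_v det(g_v)^(e_v) = 1 in F.

    In the converse, x is taken to be a generator of K^*. Its norm generates F^*, so a single
    automorphism of X decides whether sigma^b = 1. *)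

(** * Morphisms, direct summands and local endomorphism rings *)

Section RepMorphisms.

Variables (Q : quiver) (K : fieldType).
Implicit Types (d : dimvec Q).

Definition dimhom d d' := forall v, 'M[K]_(d v, d' v).

Definition rep_hom d d' (M : rep K d) (N : rep K d') (f : dimhom d d') : Prop :=
  forall a, M a *m f (target a) = f (source a) *m N a.

(** A retract rather than a pair with a chosen complement: retractions compose, and [summand_compl]
    recovers a complement when one is wanted. *)
Definition summand d d' (N : rep K d) (M : rep K d') : Prop :=
  exists (i : dimhom d d') (p : dimhom d' d),
    [/\ rep_hom N M i, rep_hom M N p & forall v, i v *m p v = 1%:M].

Lemma rep_homM d1 d2 d3 (M1 : rep K d1) (M2 : rep K d2) (M3 : rep K d3)
    (f : dimhom d1 d2) (g : dimhom d2 d3) :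
  rep_hom M1 M2 f -> rep_hom M2 M3 g -> rep_hom M1 M3 (fun v => f v *m g v).
Proof. by move=> hf hg a; rewrite mulmxA hf -mulmxA hg mulmxA. Qed.

Lemma rep_homD d1 d2 (M1 : rep K d1) (M2 : rep K d2) (f g : dimhom d1 d2) :
  rep_hom M1 M2 f -> rep_hom M1 M2 g -> rep_hom M1 M2 (fun v => f v + g v).
Proof. by move=> hf hg a; rewrite mulmxDr hf hg mulmxDl. Qed.

Lemma rep_homN d1 d2 (M1 : rep K d1) (M2 : rep K d2) (f : dimhom d1 d2) :
  rep_hom M1 M2 f -> rep_hom M1 M2 (fun v => - f v).
Proof. by move=> hf a; rewrite mulmxN hf mulNmx. Qed.

Lemma rep_hom_scalar d (M : rep K d) (c : K) : rep_hom M M (fun v => c%:M).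
Proof. by move=> a; rewrite mul_mx_scalar mul_scalar_mx. Qed.

Lemma rep_hom_inv d1 d2 (M1 : rep K d1) (M2 : rep K d2)
    (f : dimhom d1 d2) (g : dimhom d2 d1) :
  (forall v, f v *m g v = 1%:M) -> (forall v, g v *m f v = 1%:M) ->
  rep_hom M1 M2 f -> rep_hom M2 M1 g.
Proof.
move=> fg gf hf a.
by rewrite -[LHS]mul1mx -(gf (source a)) -mulmxA [f _ *m _]mulmxA -hf -!mulmxA
  fg mulmx1.
Qed.

Lemma rep_hom_invmx d (M : rep K d) (f : dimhom d d) :
  (forall v, f v \in unitmx) -> rep_hom M M f ->
  rep_hom M M (fun v => invmx (f v)).
Proof.
by move=> uf; apply: rep_hom_inv => v /=; rewrite ?mulmxV ?mulVmx ?uf.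
Qed.

Lemma rep_hom_exp d (M : rep K d) (f : dimhom d d) N :
  rep_hom M M f -> rep_hom M M (fun v => (f v : 'M_(d v)) ^+ N).
Proof.
move=> hf; elim: N => [|N IH] a; first exact: (rep_hom_scalar M 1).
by rewrite !exprSr mulmxA IH -mulmxA hf !mulmxA.
Qed.

Lemma rep_iso_refl d (M : rep K d) : rep_iso M M.
Proof.
exists (fun=> 1%:M), (fun=> 1%:M); split=> [v|a]; rewrite ?mulmx1 //.
by rewrite mul1mx.
Qed.

Lemma rep_iso_sym d d' (M : rep K d) (N : rep K d') :
  rep_iso M N -> rep_iso N M.
Proof.
move=> [g [h [gh homg]]]; exists h, g; split=> [v|].
  by have [? ?] := gh v.
by apply: rep_hom_inv homg => v; have [] := gh v.
Qed.

Lemma rep_iso_trans d1 d2 d3 (M1 : rep K d1) (M2 : rep K d2) (M3 : rep K d3) :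
  rep_iso M1 M2 -> rep_iso M2 M3 -> rep_iso M1 M3.
Proof.
move=> [g [h [gh homg]]] [g' [h' [gh' homg']]].
exists (fun v => g v *m g' v), (fun v => h' v *m h v); split=> [v|].
  have [gh1 hg1] := gh v; have [gh1' hg1'] := gh' v; split.
    by rewrite mulmxA -[g v *m _ *m _]mulmxA gh1' mulmx1.
  by rewrite mulmxA -[h' v *m _ *m _]mulmxA hg1 mulmx1.
exact: rep_homM homg homg'.
Qed.

Lemma rep_iso_dim d d' (M : rep K d) (N : rep K d') v : rep_iso M N -> d v = d' v.
Proof.
move=> [g [h [/(_ v)[gh hg] _]]]; apply/eqP; rewrite eqn_leq.
have rk m n (A : 'M[K]_(m, n)) (B : 'M[K]_(n, m)) : A *m B = 1%:M -> (m <= n)%N.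
  by move=> AB; rewrite -(mxrank1 K m) -AB (leq_trans (mxrankM_maxl _ _)) ?rank_leq_col.
by rewrite (rk _ _ _ _ gh) (rk _ _ _ _ hg).
Qed.

Lemma summand_refl d (M : rep K d) : summand M M.
Proof.
exists (fun=> 1%:M), (fun=> 1%:M); split=> [||v]; rewrite ?mulmx1 //;
  exact: rep_hom_scalar.
Qed.

Lemma summand_trans d1 d2 d3 (M1 : rep K d1) (M2 : rep K d2) (M3 : rep K d3) :
  summand M1 M2 -> summand M2 M3 -> summand M1 M3.
Proof.
move=> [i [p [hi hp ip]]] [i' [p' [hi' hp' ip']]].
exists (fun v => i v *m i' v), (fun v => p' v *m p v); split.
- exact: rep_homM hi hi'.
- exact: rep_homM hp' hp.
by move=> v; rewrite mulmxA -[i v *m _ *m _]mulmxA ip' mulmx1.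
Qed.

Lemma summand_iso d d' (M : rep K d) (N : rep K d') : rep_iso M N -> summand M N.
Proof.
move=> isoMN; have [g [h [gh hg]]] := isoMN.
exists g, h; split=> // [|v]; last by have [] := gh v.
by apply: rep_hom_inv hg => v; have [] := gh v.
Qed.

Lemma summand_dsuml d1 d2 (M1 : rep K d1) (M2 : rep K d2) :
  summand M1 (rep_dsum M1 M2).
Proof.
exists (fun v => row_mx 1%:M 0), (fun v => col_mx 1%:M 0); split=> [a|a|v].
- by rewrite mul_row_block mul_mx_row !mulmx1 !mul1mx !mulmx0 !mul0mx !addr0.
- by rewrite mul_block_col mul_col_mx !mulmx1 !mul1mx !mulmx0 !mul0mx !addr0.
by rewrite mul_row_col mulmx1 mulmx0 addr0.
Qed.

Lemma summand_dsumr d1 d2 (M1 : rep K d1) (M2 : rep K d2) :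
  summand M2 (rep_dsum M1 M2).
Proof.
exists (fun v => row_mx 0 1%:M), (fun v => col_mx 0 1%:M); split=> [a|a|v].
- by rewrite mul_row_block mul_mx_row !mulmx1 !mul1mx !mulmx0 !mul0mx !add0r.
- by rewrite mul_block_col mul_col_mx !mulmx1 !mul1mx !mulmx0 !mul0mx !add0r.
by rewrite mul_row_col mulmx1 mulmx0 add0r.
Qed.

Lemma summand_row_free d d' (N : rep K d) (M : rep K d') a :
  summand N M -> row_free (M a) -> row_free (N a).
Proof.
move=> [i [p [hi hp ip]]] /row_freeP[B MB]; apply/row_freeP.
exists (i (target a) *m B *m p (source a)).
by rewrite !mulmxA hi -[i _ *m _ *m B]mulmxA MB mulmx1 ip.
Qed.

(* Two complementary subrepresentations U and W, given by square matrices whose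
   row spaces are the subspaces. *)
Lemma split_subreps d (M : rep K d) (U W : dimhom d d) :
  (forall a, (U (source a) *m M a <= U (target a))%MS) ->
  (forall a, (W (source a) *m M a <= W (target a))%MS) ->
  (forall v, (U v :&: W v = 0)%MS) ->
  (forall v, (1%:M <= U v + W v)%MS) ->
  exists (M1 : rep K (fun v => \rank (U v))) (M2 : rep K (fun v => \rank (W v)))
         (g : forall v, 'M_(\rank (U v) + \rank (W v), d v)) h,
    [/\ rep_hom (rep_dsum M1 M2) M g,
     forall v, g v = col_mx (row_base (U v)) (row_base (W v)) &
     forall v, g v *m h v = 1%:M /\ h v *m g v = 1%:M].
Proof.
move=> sU sW UW0 UW1.
pose g v := col_mx (row_base (U v)) (row_base (W v)).
have gE v : (g v :=: U v + W v)%MS.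
  apply: eqmx_trans (eqmx_sym (addsmxE _ _)) _.
  exact: adds_eqmx (eq_row_base _) (eq_row_base _).
have rk v : (\rank (U v) + \rank (W v))%N = d v.
  rewrite -mxrank_disjoint_sum //; apply/eqP.
  by rewrite -[_ == _]/(row_full _) -sub1mx.
have gfree v : row_free (g v).
  by rewrite -row_leq_rank gE mxrank_disjoint_sum.
pose M1 : rep K (fun v => \rank (U v)) := fun a =>
  row_base (U (source a)) *m M a *m pinvmx (row_base (U (target a))).
pose M2 : rep K (fun v => \rank (W v)) := fun a =>
  row_base (W (source a)) *m M a *m pinvmx (row_base (W (target a))).
exists M1, M2, g, (fun v => pinvmx (g v)); split=> // [a|v].
  rewrite mul_block_col !mul0mx addr0 add0r mul_col_mx.
  have sub (Z : dimhom d d) : (Z (source a) *m M a <= Z (target a))%MS ->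
      (row_base (Z (source a)) *m M a <= row_base (Z (target a)))%MS.
    move=> sZ; rewrite eq_row_base (submx_trans _ sZ) //.
    by rewrite submxMr ?eq_row_base.
  by rewrite !mulmxKpV ?sub.
have gh : g v *m pinvmx (g v) = 1%:M by apply/mulmxVp.
by split=> //; rewrite mulVpmx // -sub1mx gE.
Qed.

Lemma split_iso d (M : rep K d) (U W : dimhom d d) :
  (forall a, (U (source a) *m M a <= U (target a))%MS) ->
  (forall a, (W (source a) *m M a <= W (target a))%MS) ->
  (forall v, (U v :&: W v = 0)%MS) ->
  (forall v, (1%:M <= U v + W v)%MS) ->
  exists (M1 : rep K (fun v => \rank (U v))) (M2 : rep K (fun v => \rank (W v))),
    rep_iso M (rep_dsum M1 M2).
Proof.
move=> sU sW UW0 UW1; have [M1 [M2 [g [h [homg _ gh]]]]] := split_subreps sU sW UW0 UW1.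
by exists M1, M2; apply: rep_iso_sym; exists g, h.
Qed.

(** The complement is the image of the idempotent [e], and the rows of [w v] are a basis of it. *)
Lemma summand_compl d d' (N : rep K d) (M : rep K d') :
  summand N M -> exists c (N' : rep K c), rep_iso M (rep_dsum N N').
Proof.
move=> [i [p [hi hp ip]]].
pose e v := 1%:M - p v *m i v; pose w v := row_base (e v).
have he : rep_hom M M e.
  apply: rep_homD; first exact: (rep_hom_scalar M 1).
  apply: rep_homN; exact: rep_homM hp hi.
have ep v : e v *m p v = 0 by rewrite mulmxBl mul1mx -mulmxA ip mulmx1 subrr.
have ie v : i v *m e v = 0 by rewrite mulmxBr mulmx1 mulmxA ip mul1mx subrr.
have ee v : e v *m e v = e v.
  by rewrite {2}/e mulmxBr mulmx1 mulmxA ep mul0mx subr0.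
have we v : w v *m e v = w v.
  have /submxP[y wy] : (w v <= e v)%MS by rewrite eq_row_base.
  by rewrite wy -mulmxA ee.
have ew v : e v *m pinvmx (w v) *m w v = e v.
  by rewrite mulmxKpV // eq_row_base.
have ww v : w v *m pinvmx (w v) = 1%:M by apply/mulmxVp/row_base_free.
exists (fun v => \rank (e v)), (fun a => w (source a) *m M a *m pinvmx (w (target a))).
apply: rep_iso_sym.
exists (fun v => col_mx (i v) (w v)), (fun v => row_mx (p v) (e v *m pinvmx (w v))).
split=> [v|a].
  split; last by rewrite mul_row_col ew addrC subrK.
  have wp : w v *m p v = 0 by rewrite -we -mulmxA ep mulmx0.
  rewrite mul_col_row ip wp (mulmxA (i v)) ie mul0mx (mulmxA (w v)) we ww.
  by rewrite -scalar_mx_block.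
rewrite mul_block_col !mul0mx addr0 add0r mul_col_mx hi; congr col_mx.
rewrite mulmxKpV // -we -mulmxA -he mulmxA.
by rewrite /w eq_row_base submxMl.
Qed.

Definition total_dim d := (\sum_v d v)%N.

Lemma dimvec_posP d : reflect (dimvec_pos d) (0 < total_dim d)%N.
Proof.
rewrite lt0n sum_nat_eq0 negb_forall; apply: (iffP existsP) => -[v dv]; exists v.
  by rewrite lt0n.
by rewrite /= -lt0n.
Qed.

Lemma total_dimD d d' :
  total_dim (fun v => d v + d' v)%N = (total_dim d + total_dim d')%N.
Proof. exact: big_split. Qed.

Lemma total_dim_iso d d' (M : rep K d) (N : rep K d') :
  rep_iso M N -> total_dim d = total_dim d'.
Proof. by move=> isoMN; apply: eq_bigr => v _; apply: rep_iso_dim isoMN. Qed.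

Lemma decomposableP d (M : rep K d) : dimvec_pos d -> ~ indecomposable M ->
  exists d1 d2 (M1 : rep K d1) (M2 : rep K d2),
    [/\ rep_iso M (rep_dsum M1 M2), dimvec_pos d1 & dimvec_pos d2].
Proof.
move=> dpos nind; apply: contrapT => H; apply: nind; split=> // d1 d2 M1 M2 iso.
by move=> [pos1 pos2]; apply: H; exists d1, d2, M1, M2.
Qed.

Lemma indecomposable_summand d (M : rep K d) : dimvec_pos d ->
  exists d' (N : rep K d'), indecomposable N /\ summand N M.
Proof.
move: {2}(total_dim d) (leqnn (total_dim d)) => n.
elim: n d M => [|n IH] d M dn dpos.
  by move/dimvec_posP: dpos; rewrite ltnNge dn.
have [ind|nind] := pselect (indecomposable M).
  by exists d, M; split=> //; apply: summand_refl.
have [d1 [d2 [M1 [M2 [iso pos1 pos2]]]]] := decomposableP dpos nind.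
have [|d' [N [indN sN]]] := IH d1 M1 _ pos1.
  move: dn; rewrite (total_dim_iso iso) total_dimD.
  by move/dimvec_posP: pos2; lia.
exists d', N; split=> //; apply: summand_trans sN _.
apply: summand_trans (summand_dsuml M1 M2) _.
exact/summand_iso/rep_iso_sym.
Qed.

(** One exponent must serve all vertices. It minimises the sum of the ranks: each rank can only drop
    when the exponent is doubled, so none does, and then kernel and image meet trivially. It is
    positive so that an invertible power forces [h] itself to be invertible. *)
Lemma fitting d (h : dimhom d d) : exists N, forall v,
  (kermx ((h v : 'M_(d v)) ^+ N.+1) :&: (h v : 'M_(d v)) ^+ N.+1 = 0)%MS /\
  (1%:M <= kermx ((h v : 'M_(d v)) ^+ N.+1) + (h v : 'M_(d v)) ^+ N.+1)%MS.
Proof.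
pose r N := (\sum_v \rank ((h v : 'M_(d v)) ^+ N.+1))%N.
have [N Nmin] : exists N, forall N', (r N <= r N')%N.
  have [n /asboolP[N rN] nmin] : exists2 n, `[< exists N, r N = n >] &
      forall n', `[< exists N, r N = n' >] -> (n <= n')%N.
    have ex : exists n, `[< exists N, r N = n >] by exists (r 0%N); apply/asboolP; exists 0%N.
    by exists (ex_minn ex); case: ex_minnP.
  by exists N => N'; rewrite rN; apply: nmin; apply/asboolP; exists N'.
have rk v : \rank ((h v : 'M_(d v)) ^+ N.+1 *m (h v : 'M_(d v)) ^+ N.+1)
    = \rank ((h v : 'M_(d v)) ^+ N.+1).
  rewrite [in LHS](_ : _ *m _ = (h v : 'M_(d v)) ^+ (N + N.+1).+1); last first.
    by rewrite -addSn exprD.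
  have le v' : (\rank ((h v' : 'M_(d v')) ^+ (N + N.+1).+1) <=
      \rank ((h v' : 'M_(d v')) ^+ N.+1))%N.
    by rewrite -addSn exprD mxrankM_maxl.
  apply/eqP; rewrite eqn_leq le leqNgt; apply/negP => lt.
  have := Nmin (N + N.+1)%N; rewrite leqNgt => /negP; apply.
  by rewrite /r (bigD1 v) //= [X in (_ < X)%N](bigD1 v) //= -addSn leq_add ?leq_sum.
exists N => v; set A := (h v : 'M_(d v)) ^+ N.+1 in rk *.
have A0 : (kermx A :&: A = 0)%MS.
  have := mxrank_mul_ker A A; rewrite rk => /eqP; rewrite -[X in _ == X]addn0 eqn_add2l.
  by rewrite mxrank_eq0 capmxC => /eqP.
split=> //; rewrite sub1mx /row_full mxrank_disjoint_sum // mxrank_ker subnK //.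
exact: rank_leq_row.
Qed.

(** Kernel and image of the power from [fitting] are subrepresentations that split [M], so one of
    them vanishes. In this sense the endomorphism ring is local. *)
Lemma indecomposable_endo d (M : rep K d) (h : dimhom d d) :
  indecomposable M -> rep_hom M M h ->
  (forall v, h v \in unitmx) \/
  exists N, forall v, (h v : 'M_(d v)) ^+ N = 0.
Proof.
move=> [dpos ind] hh; have [N hN] := fitting h.
have hhN := rep_hom_exp N.+1 hh.
have [|||v|M1 [M2 iso]] := @split_iso _ M
  (fun v => kermx ((h v : 'M_(d v)) ^+ N.+1)) (fun v => (h v : 'M_(d v)) ^+ N.+1).
- by move=> a; apply/sub_kermxP; rewrite -mulmxA hhN mulmxA mulmx_ker mul0mx.
- by move=> a; rewrite -hhN submxMl.
- by move=> v; have [] := hN v.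
- by have [] := hN v.
have := ind _ _ _ _ iso => nboth.
have [pos1|npos1] := pselect (dimvec_pos (fun v => \rank (kermx ((h v : 'M_(d v)) ^+ N.+1)))).
  right; exists N.+1 => v; apply/eqP; rewrite -mxrank_eq0 -leqn0 leqNgt; apply/negP => pos2.
  by apply: nboth; split=> //; exists v.
left=> v; have : kermx ((h v : 'M_(d v)) ^+ N.+1) == 0.
  by rewrite -mxrank_eq0 -leqn0 leqNgt; apply/negP => pos1; apply: npos1; exists v.
rewrite kermx_eq0 row_free_unit exprS unitmxE det_mulmx unitrM -unitmxE.
by case/andP.
Qed.

(** Such an [h] is nilpotent, and the geometric series in [- h] inverts [1%:M + h]. *)
Lemma indecomposable_add1_unit d (M : rep K d) (h : dimhom d d) :
  indecomposable M -> rep_hom M M h -> ~ (forall v, h v \in unitmx) ->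
  forall v, 1%:M + h v \in unitmx.
Proof.
move=> indM /(indecomposable_endo indM)[//|[N hN]] _ v.
have /(congr1 (@GRing.opp _)) := subrX1 (- h v : 'M_(d v)) N.
rewrite exprNn hN mulr0 sub0r opprK -mulNr opprB opprK => H1.
by have [] := mulmx1_unit (esym H1).
Qed.

(** * Products of characters of determinants on automorphism groups *)

Section AutCharacter.

Variables (chi : vertex Q -> K -> algC).
Hypothesis chi1 : forall v, chi v 1 = 1.
Hypothesis chiM : forall v, {morph chi v : x y / x * y}.

Definition det_char d (g : dimhom d d) : algC := \prod_v chi v (\det (g v)).

Definition aut_trivial d (M : rep K d) : Prop :=
  forall g : dimhom d d, rep_hom M M g -> (forall v, g v \in unitmx) ->
    det_char g = 1.

Lemma det_charM d (g h : dimhom d d) :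
  det_char (fun v => g v *m h v) = det_char g * det_char h.
Proof.
by rewrite /det_char -big_split; apply: eq_bigr => v _; rewrite det_mulmx chiM.
Qed.

(** Both sides are the determinant of [X], which becomes block triangular on multiplication by the
    same unipotent matrix from the right or from the left. *)
Lemma det_1_addMC m n (A : 'M[K]_(m, n)) (B : 'M[K]_(n, m)) :
  \det (1%:M + A *m B) = \det (1%:M + B *m A).
Proof.
pose X := block_mx 1%:M (- A) B 1%:M.
have E1 : X *m block_mx 1%:M A 0 1%:M = block_mx 1%:M 0 B (1%:M + B *m A).
  rewrite mulmx_block !mulmx1 !mul1mx !mulmx0 !addr0 subrr.
  by rewrite addrC.
have E2 : block_mx 1%:M A 0 1%:M *m X = block_mx (1%:M + A *m B) 0 B 1%:M.
  rewrite mulmx_block !mulmx1 !mul1mx !mul0mx !add0r addNr.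
  by [].
have := congr1 (fun X => \det X) E1; have := congr1 (fun X => \det X) E2.
by rewrite !det_mulmx det_ublock !det_lblock !det1 !mul1r !mulr1 => -> ->.
Qed.

(** [g1] extends [g] by the identity on the kernel of [p]; by [det_1_addMC] it has the same
    determinants as [g]. *)
Lemma aut_trivial_summand d d' (N : rep K d) (M : rep K d') :
  summand N M -> aut_trivial M -> aut_trivial N.
Proof.
move=> [i [p [hi hp ip]]] trM g hg ug.
pose g1 v := 1%:M + p v *m ((g v - 1%:M) *m i v).
have detg v : \det (g1 v) = \det (g v).
  by rewrite det_1_addMC -mulmxA ip mulmx1 addrC subrK.
rewrite -(trM g1); first by apply: eq_bigr => v _; rewrite detg.
  apply: rep_homD; first exact: (rep_hom_scalar M 1).
  apply: rep_homM hp _; apply: rep_homM hi.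
  by apply: rep_homD => //; apply/rep_homN/(rep_hom_scalar N 1).
by move=> v; rewrite unitmxE detg -unitmxE.
Qed.

Lemma rep_dsum_homP d1 d2 (A : rep K d1) (B : rep K d2)
    (a : dimhom d1 d1) (b : dimhom d1 d2) (c : dimhom d2 d1) (e : dimhom d2 d2) :
  rep_hom (rep_dsum A B) (rep_dsum A B)
    (fun v => block_mx (a v) (b v) (c v) (e v)) <->
  [/\ rep_hom A A a, rep_hom A B b, rep_hom B A c & rep_hom B B e].
Proof.
split=> [H|[ha hb hc he] x].
  have H' x : [/\ A x *m a (target x) = a (source x) *m A x,
      A x *m b (target x) = b (source x) *m B x,
      B x *m c (target x) = c (source x) *m A x &
      B x *m e (target x) = e (source x) *m B x].
    have := H x; rewrite !mulmx_block !mul0mx !mulmx0 !addr0 !add0r.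
    by move/eq_block_mx=> [-> -> -> ->].
  by split=> x; have [] := H' x.
by rewrite !mulmx_block !mul0mx !mulmx0 !addr0 !add0r ha hb hc he.
Qed.

(** Elimination with the pivot [a] leaves the Schur complement [s], an automorphism of [B], and the
    determinant at each vertex is that of [a] times that of [s]. *)
Lemma aut_trivial_dsum_pivot d1 d2 (A : rep K d1) (B : rep K d2)
    (a : dimhom d1 d1) (b : dimhom d1 d2) (c : dimhom d2 d1) (e : dimhom d2 d2) :
  aut_trivial A -> aut_trivial B ->
  rep_hom (rep_dsum A B) (rep_dsum A B)
    (fun v => block_mx (a v) (b v) (c v) (e v)) ->
  (forall v, block_mx (a v) (b v) (c v) (e v) \in unitmx) ->
  (forall v, a v \in unitmx) ->
  det_char (fun v => block_mx (a v) (b v) (c v) (e v)) = 1.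
Proof.
move=> trA trB /rep_dsum_homP[ha hb hc he] ug ua.
pose s v := e v - c v *m invmx (a v) *m b v.
have detg v : \det (block_mx (a v) (b v) (c v) (e v)) = \det (a v) * \det (s v).
  have -> : block_mx (a v) (b v) (c v) (e v) =
      block_mx 1%:M 0 (c v *m invmx (a v)) 1%:M *m block_mx (a v) (b v) 0 (s v).
    rewrite mulmx_block !mul1mx !mul0mx !addr0 mulmxKV ?ua //.
    by rewrite /s [_ + (_ - _)]addrC subrK.
  by rewrite det_mulmx det_lblock det_ublock !det1 !mul1r.
transitivity (det_char a * det_char s).
  by rewrite /det_char -big_split; apply: eq_bigr => v _; rewrite detg chiM.
rewrite trA // trB ?mulr1 //.
  apply: rep_homD => //; apply: rep_homN; apply: rep_homM hb.
  by apply: rep_homM hc _; apply: rep_hom_invmx.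
by move=> v; have := ug v; rewrite !unitmxE detg unitrM => /andP[].
Qed.

(* If the corner a of g is not invertible, a column operation with the corner c'
   of g^-1 makes it so: a a' + b c' = 1 and A has a local endomorphism ring. *)
Lemma aut_trivial_dsum d1 d2 (A : rep K d1) (B : rep K d2) :
  indecomposable A -> aut_trivial A -> aut_trivial B ->
  aut_trivial (rep_dsum A B).
Proof.
move=> indA trA trB g hg ug.
pose h v := invmx (g v).
have hh : rep_hom (rep_dsum A B) (rep_dsum A B) h by apply: rep_hom_invmx.
pose a v := ulsubmx (g v); pose b v := ursubmx (g v).
pose c v := dlsubmx (g v); pose e v := drsubmx (g v).
pose a' v := ulsubmx (h v); pose c' v := dlsubmx (h v).
have gE : g = fun v => block_mx (a v) (b v) (c v) (e v).
  by apply/functional_extensionality_dep => v; rewrite submxK.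
have hE : h = fun v => block_mx (a' v) (ursubmx (h v)) (c' v) (drsubmx (h v)).
  by apply/functional_extensionality_dep => v; rewrite submxK.
have [ha hb hc he] : [/\ rep_hom A A a, rep_hom A B b, rep_hom B A c & rep_hom B B e].
  by apply/rep_dsum_homP; have := hg; rewrite {1}gE.
have [ha' _ hc' _] : [/\ rep_hom A A a', rep_hom A B (fun v => ursubmx (h v)),
    rep_hom B A c' & rep_hom B B (fun v => drsubmx (h v))].
  by apply/rep_dsum_homP; have := hh; rewrite {1}hE.
have aa' v : a v *m a' v + b v *m c' v = 1%:M.
  have := mulmxV (ug v); rewrite -/(h v) gE hE mulmx_block (scalar_mx_block _ _ 1).
  by case/eq_block_mx.
have [ua|nua] := pselect (forall v, a v \in unitmx).
  by rewrite gE; apply: (aut_trivial_dsum_pivot trA trB) => // [|v]; [have := hg|have := ug v]; rewrite {1}gE.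
(* [a a'] is not an automorphism because [a] is not, so [b c' = 1 - a a'] is one. *)
have ubc : forall v, b v *m c' v \in unitmx.
  have haa : rep_hom A A (fun v => - (a v *m a' v)).
    by apply: rep_homN; apply: rep_homM ha ha'.
  have nu : ~ forall v, - (a v *m a' v) \in unitmx.
    move=> u; apply: nua => v; have := u v.
    rewrite -mulNmx unitmxE det_mulmx unitrM -unitmxE => /andP[+ _].
    by rewrite -scaleN1r unitmxZ ?unitrN1.
  by move=> v; have := indecomposable_add1_unit indA haa nu v; rewrite -(aa' v) addrAC subrr add0r.
(* The sum is [(a (b c')^-1 + 1) (b c')], and [a (b c')^-1] is not an automorphism because [a] is
   not. *)
have uabc v : a v + b v *m c' v \in unitmx.
  have hw : rep_hom A A (fun v => a v *m invmx (b v *m c' v)).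
    by apply: rep_homM ha _; apply: rep_hom_invmx => //; apply: rep_homM hb hc'.
  have nu : ~ forall v, a v *m invmx (b v *m c' v) \in unitmx.
    move=> u; apply: nua => w; have := u w.
    by rewrite unitmxE det_mulmx unitrM -unitmxE => /andP[].
  have := indecomposable_add1_unit indA hw nu v.
  rewrite addrC => u1.
  by rewrite -[a v](mulmxKV (ubc v)) -{3}[b v *m c' v]mul1mx -mulmxDl unitmxE
    det_mulmx unitrM -!unitmxE u1 ubc.
pose t v : 'M[K]_(d1 v + d2 v) := block_mx 1%:M 0 (c' v) 1%:M.
have dt v : \det (t v) = 1 by rewrite det_lblock !det1 mulr1.
have ht : rep_hom (rep_dsum A B) (rep_dsum A B) t.
  apply/rep_dsum_homP; split=> //; try exact: (rep_hom_scalar _ 1).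
  by move=> x; rewrite mulmx0 mul0mx.
have -> : det_char g = det_char (fun v => g v *m t v).
  by rewrite det_charM [X in _ * X]big1 ?mulr1 // => v _; rewrite dt chi1.
have gtE : (fun v => g v *m t v) = fun v => block_mx (a v + b v *m c' v) (b v)
    (c v + e v *m c' v) (e v).
  apply/functional_extensionality_dep => v; rewrite [in LHS]gE mulmx_block.
  by rewrite !mulmx1 !mulmx0 !add0r.
rewrite gtE; apply: (aut_trivial_dsum_pivot trA trB) => // [|v].
  by have := rep_homM hg ht; rewrite {1}gtE.
have := congr1 (fun f => f v) gtE => /= <-.
by rewrite unitmxE det_mulmx dt mulr1 -unitmxE.
Qed.

(* X is a direct summand of a power of M. *)
Definition add_closure d d' (X : rep K d) (M : rep K d') : Prop :=
  exists n (i : 'I_n -> dimhom d d') (p : 'I_n -> dimhom d' d),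
  [/\ forall t, rep_hom X M (i t), forall t, rep_hom M X (p t) &
   forall v, \sum_t i t v *m p t v = 1%:M].

Lemma add_closure_summand d1 d2 d3 (X : rep K d1) (Y : rep K d2) (M : rep K d3) :
  summand X Y -> add_closure Y M -> add_closure X M.
Proof.
move=> [i [p [hi hp ip]]] [n [i' [p' [hi' hp' ip']]]].
exists n, (fun t v => i v *m i' t v), (fun t v => p' t v *m p v); split=> [t|t|v].
- exact: rep_homM hi (hi' t).
- exact: rep_homM (hp' t) hp.
transitivity (i v *m (\sum_t i' t v *m p' t v) *m p v).
  by rewrite mulmx_sumr mulmx_suml; apply: eq_bigr => t _; rewrite !mulmxA.
by rewrite ip' mulmx1 ip.
Qed.

(** With [s] the whole sum: if [h ord0] is not invertible, then [1 - h ord0 s^-1] is, and its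
    product with [s] is the sum of the remaining terms. *)
Lemma indecomposable_sum_unit d (A : rep K d) n (h : 'I_n -> dimhom d d) :
  indecomposable A -> (forall t, rep_hom A A (h t)) ->
  (forall v, \sum_t h t v \in unitmx) -> exists t, forall v, h t v \in unitmx.
Proof.
move=> indA; elim: n h => [|n IH] h hh uh.
  have [[v dv] _] := indA; have := uh v.
  by rewrite big_ord0 unitmxE; case: (d v) dv => // ? _; rewrite det0 unitr0.
have [u0|nu0] := pselect (forall v, h ord0 v \in unitmx); first by exists ord0.
have [|v|t] := IH (fun t => h (lift ord0 t)); last 1 first.
- by exists (lift ord0 t).
- by move=> t; apply: hh.
pose s v := \sum_t h t v.
have hs : rep_hom A A s.
  by move=> a; rewrite mulmx_sumr mulmx_suml; apply: eq_bigr => t _; apply: hh.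
have hw : rep_hom A A (fun v => - (h ord0 v *m invmx (s v))).
  by apply: rep_homN; apply: rep_homM (hh _) _; apply: rep_hom_invmx.
have nu : ~ forall v, - (h ord0 v *m invmx (s v)) \in unitmx.
  move=> u; apply: nu0 => w; have := u w.
  rewrite -mulNmx unitmxE det_mulmx unitrM -unitmxE => /andP[+ _].
  by rewrite -scaleN1r unitmxZ ?unitrN1.
have := indecomposable_add1_unit indA hw nu v => u1.
have : (1%:M - h ord0 v *m invmx (s v)) *m s v \in unitmx.
  by rewrite unitmxE det_mulmx unitrM -!unitmxE u1 uh.
rewrite mulmxBl mul1mx mulmxKV ?uh // /s big_ord_recl.
by rewrite addrAC subrr add0r.
Qed.

(** Induction on the dimension, splitting off an indecomposable summand [A] of [X]. Its identity is
    a sum of endomorphisms that factor through [M]; one of them is invertible by locality, which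
    makes [A] a summand of [M] itself. *)
Lemma aut_trivial_add_closure d d' (X : rep K d) (M : rep K d') :
  add_closure X M -> aut_trivial M -> aut_trivial X.
Proof.
move=> + trM; move: {2}(total_dim d) (leqnn (total_dim d)) => n.
elim: n d X => [|n IH] d X dn addX.
  move=> g _ _; apply: big1 => v _.
  have dv : d v = 0%N.
    by move: dn; rewrite leqn0 /total_dim sum_nat_eq0 => /forallP/(_ v)/eqP.
  by move: (g v); rewrite dv => A; rewrite det_mx00.
have [dpos|ndpos] := pselect (dimvec_pos d); last first.
  by apply: IH addX; case: (posnP (total_dim d)) => [->//|/dimvec_posP].
have [d1 [A [indA sA]]] := indecomposable_summand X dpos.
have [d2 [B iso]] := summand_compl sA.
have trA : aut_trivial A.
  have [m [i [p [hi hp ip]]]] := add_closure_summand sA addX.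
  have [t|v|t ut] := @indecomposable_sum_unit _ A m (fun t v => i t v *m p t v) indA.
  - exact: rep_homM (hi t) (hp t).
  - by rewrite ip unitmx1.
  apply: aut_trivial_summand trM.
  exists (i t), (fun v => p t v *m invmx (i t v *m p t v)); split=> // [|v].
    by apply: rep_homM (hp t) _; apply: rep_hom_invmx ut _; apply: rep_homM (hi t) (hp t).
  by rewrite mulmxA mulmxV.
have trB : aut_trivial B.
  apply: IH.
    move: dn; rewrite (total_dim_iso iso) total_dimD.
    by have [/dimvec_posP + _] := indA; lia.
  apply: add_closure_summand addX.
  apply: summand_trans (summand_dsumr A B) _.
  exact/summand_iso/rep_iso_sym.
apply: aut_trivial_summand (summand_iso iso) _.
exact: aut_trivial_dsum.
Qed.

End AutCharacter.
End RepMorphisms.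

(** The level condition constrains indecomposable summands, whereas kernels and generalized
    eigenspaces are arbitrary ones; additive conditions pass from the former to the latter.
    Dimensions add pointwise because [rep_iso] identifies them vertex by vertex. *)
Lemma summand_ind (Q : quiver) (K : fieldType) (d : dimvec Q) (M : rep K d)
    (P : dimvec Q -> Prop) :
  (forall b, ~ dimvec_pos b -> P b) ->
  (forall b b1 b2, (forall v, b v = b1 v + b2 v)%N -> P b1 -> P b2 -> P b) ->
  (forall b (N : rep K b), indecomposable N -> summand N M -> P b) ->
  forall b (N : rep K b), summand N M -> P b.
Proof.
move=> P0 PD Pind b; move: {2}(total_dim b) (leqnn (total_dim b)) => n.
elim: n b => [|n IH] b bn N sN.
  by apply: P0 => /dimvec_posP; lia.
have [bpos|] := pselect (dimvec_pos b); last exact: P0.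
have [indN|nindN] := pselect (indecomposable N); first exact: Pind sN.
have [b1 [b2 [N1 [N2 [iso /dimvec_posP pos1 /dimvec_posP pos2]]]]] :=
  decomposableP bpos nindN.
have bD := total_dim_iso iso; rewrite total_dimD in bD.
have sN12 := summand_trans (summand_iso (rep_iso_sym iso)) sN.
apply: (PD b b1 b2); first by move=> v; apply: rep_iso_dim iso.
  by apply: (IH b1 _ N1); [lia|exact: summand_trans (summand_dsuml _ _) sN12].
by apply: (IH b2 _ N2); [lia|exact: summand_trans (summand_dsumr _ _) sN12].
Qed.

(** * Characteristic polynomials and generalized eigenspaces *)

Section CharPoly.

Variable K : fieldType.

Lemma char_poly_conj m n (A : 'M[K]_m) (B : 'M[K]_n) (g : 'M_(m, n)) (h : 'M_(n, m)) :
  g *m h = 1%:M -> h *m g = 1%:M -> A *m g = g *m B -> char_poly A = char_poly B.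
Proof.
move=> gh hg.
have mn : m = n.
  have := mulmx1_min gh; have := mulmx1_min hg; lia.
move: B g h gh hg; rewrite -mn => B g h gh hg AgB.
have -> : A = g *m B *m h by rewrite -AgB -mulmxA gh mulmx1.
rewrite /char_poly; set gP := map_mx polyC g; set hP := map_mx polyC h.
have ghP : gP *m hP = 1%:M by rewrite -map_mxM gh map_mx1.
have -> : char_poly_mx (g *m B *m h) = gP *m char_poly_mx B *m hP.
  rewrite /char_poly_mx mulmxBr mulmxBl !map_mxM; congr (_ - _).
  by rewrite mul_mx_scalar -scalemxAl ghP scalemx1.
by rewrite !det_mulmx mulrAC -det_mulmx ghP det1 mul1r.
Qed.

Lemma char_poly_block_diag m n (A : 'M[K]_m) (B : 'M[K]_n) :
  char_poly (block_mx A 0 0 B) = char_poly A * char_poly B.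
Proof. by rewrite /char_poly char_block_diag_mx det_ublock. Qed.

End CharPoly.

Section ClosedFieldCharPoly.

Variable K : closedFieldType.

Lemma char_poly_closed n (A : 'M[K]_n) :
  exists s, char_poly A = \prod_(z <- s) ('X - z%:P).
Proof.
have [s sE] := closed_field_poly_normal (char_poly A); exists s.
by move: sE; rewrite (monicP (char_poly_monic A)) scale1r.
Qed.

(** The block of [A] on the kernel [U] has no eigenvalue except [z], because a power of [A - z]
    kills [U]. The block on the image [W] does not have the eigenvalue [z], because an eigenvector
    would lie in both spaces. So the roots equal to [z] are exactly those of the first block. *)
Lemma rank_geigenspace n (A : 'M[K]_n) (z : K) (s : seq K) N :
  char_poly A = \prod_(x <- s) ('X - x%:P) ->
  (kermx ((A - z%:M) ^+ N.+1) :&: (A - z%:M) ^+ N.+1 = 0)%MS ->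
  (1%:M <= kermx ((A - z%:M) ^+ N.+1) + (A - z%:M) ^+ N.+1)%MS ->
  \rank (kermx ((A - z%:M) ^+ N.+1)) = count_mem z s.
Proof.
set h := A - z%:M; set U := kermx _; set W := h ^+ _ => As UW0 UW1.
(* A is a representation of the one-loop quiver. *)
pose Q := @Quiver unit unit id id.
have Ah : A *m W = W *m A.
  have cAh : GRing.comm A h.
    rewrite /GRing.comm /h mulrBr mulrBl; congr (_ - _).
    by rewrite -[LHS]/(_ *m _) -[RHS]/(_ *m _) mul_mx_scalar mul_scalar_mx.
  exact: commrX.
have [M1 [M2 [g [k [homg gE gk kg]]]]] :
    exists (M1 : 'M[K]_(\rank U)) (M2 : 'M[K]_(\rank W)) g k,
    [/\ block_mx M1 0 0 M2 *m g = g *m A, g = col_mx (row_base U) (row_base W),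
     g *m k = 1%:M & k *m g = 1%:M].
  have [||||M1 [M2 [g [k [homg gE gk]]]]] := @split_subreps Q K (fun=> n) (fun=> A)
    (fun=> U) (fun=> W).
  - by move=> _; apply/sub_kermxP; rewrite -mulmxA Ah mulmxA mulmx_ker mul0mx.
  - by move=> _; rewrite -Ah submxMl.
  - by [].
  - by [].
  exists (M1 tt), (M2 tt), (g tt), (k tt).
  have [gk1 kg1] := gk tt; exact: And4 (homg tt) (gE tt) gk1 kg1.
have := char_poly_conj gk kg homg; rewrite char_poly_block_diag As.
have [s1 s1E] := char_poly_closed M1; have [s2 s2E] := char_poly_closed M2.
rewrite s1E s2E -big_cat => /esym/prod_XsubC_eq/seq.permP/(_ (pred1 z)) ->.
move: homg; rewrite gE mul_block_col !mul0mx addr0 add0r mul_col_mx.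
case/eq_col_mx => MU MW.
have MUz x : (M1 - x%:M) *m row_base U = row_base U *m (A - x%:M).
  by rewrite mulmxBl mulmxBr MU mul_scalar_mx mul_mx_scalar.
have MWz x : (M2 - x%:M) *m row_base W = row_base W *m (A - x%:M).
  by rewrite mulmxBl mulmxBr MW mul_scalar_mx mul_mx_scalar.
have s1z : all (pred1 z) s1.
  apply/allP => x; rewrite -root_prod_XsubC -s1E -eigenvalue_root_char.
  case/eigenvalueP=> u ux u0 /=; apply/eqP.
  have ux' j : u *m (M1 - z%:M) ^+ j = (x - z) ^+ j *: u.
    elim: j => [|j IH]; first by rewrite !expr0 mulmx1 scale1r.
    rewrite exprSr -[_ * _]/(_ *m _) mulmxA IH -scalemxAl mulmxBr ux mul_mx_scalar.
    by rewrite -scalerBl scalerA exprSr.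
  have MUj j : (M1 - z%:M) ^+ j *m row_base U = row_base U *m h ^+ j.
    elim: j => [|j IH]; first by rewrite !expr0 mul1mx mulmx1.
    rewrite !exprSr -[_ * _]/(_ *m _) -[h ^+ j * h]/(_ *m _).
    by rewrite -mulmxA MUz mulmxA IH mulmxA.
  have : u *m (M1 - z%:M) ^+ N.+1 *m row_base U = 0.
    have U0 : row_base U *m h ^+ N.+1 = 0 by apply/sub_kermxP; rewrite eq_row_base.
    by rewrite -mulmxA MUj U0 mulmx0.
  move/eqP; rewrite mulmx_free_eq0 ?row_base_free // ux' scaler_eq0 (negPf u0) orbF.
  by rewrite expf_eq0 subr_eq0 => /eqP.
have s2z : z \notin s2.
  apply/negP; rewrite -root_prod_XsubC -s2E -eigenvalue_root_char.
  case/eigenvalueP=> u ux /negP; apply; rewrite -(mulmx_free_eq0 _ (row_base_free W)).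
  rewrite -submx0 -UW0 sub_capmx; apply/andP; split; last first.
    by rewrite (submx_trans (submxMl _ _)) ?eq_row_base.
  have XW (X : 'rV_n) : X *m W = X *m h *m h ^+ N by rewrite /W exprS -mulmxA.
  apply/sub_kermxP; rewrite [LHS]XW -[_ *m row_base W *m h]mulmxA.
  by rewrite -MWz mulmxA mulmxBr ux mul_mx_scalar subrr !mul0mx.
rewrite count_cat (count_memPn s2z) addn0.
move: s1z; rewrite all_count => /eqP ->.
have := congr1 (fun p : {poly K} => size p) s1E.
by rewrite size_char_poly size_prod_XsubC => -[].
Qed.

End ClosedFieldCharPoly.

(** * The Frobenius map and determinants of automorphisms *)

Section Frobenius.

Variable F : finFieldType.
Local Notation L := (alg_closure F).
Local Notation iota := (to_alg_closure F).
Local Notation q := #|F|.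

Definition frobenius (z : L) : L := z ^+ q.

Lemma frobenius_semilinear :
  {morph frobenius : x y / x + y} /\ (frobenius 0 = 0).
Proof.
have [p pr_p pcharFp] := finPcharP F.
have q_nat : [pchar L].-nat q.
  rewrite (card_pprimeChar pcharFp).
  rewrite pnatX; apply/orP; left.
  have pL : p \in [pchar L] by rewrite (fmorph_pchar iota).
  by rewrite pnatE.
split=> [x y|]; first exact: exprDn_pchar.
by rewrite /frobenius expr0n; have := finNzRing_gt1 F; case: q.
Qed.

Lemma frobenius_is_zmod_morphism : zmod_morphism frobenius.
Proof.
have [fD f0] := frobenius_semilinear => x y.
by apply: (addIr (frobenius y)); rewrite -fD !subrK.
Qed.

Lemma frobenius_is_monoid_morphism : monoid_morphism frobenius.
Proof. by split=> [|x y]; rewrite /frobenius ?expr1n // exprMn. Qed.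

HB.instance Definition _ :=
  GRing.isZmodMorphism.Build L L frobenius frobenius_is_zmod_morphism.
HB.instance Definition _ :=
  GRing.isMonoidMorphism.Build L L frobenius frobenius_is_monoid_morphism.

Lemma frobenius_iota x : frobenius (iota x) = iota x.
Proof. by rewrite /frobenius -rmorphXn expf_card. Qed.

(** Fixed points are roots of X^q - X, which already splits over [F]. *)
Lemma frobenius_fixed z : frobenius z = z -> exists x, z = iota x.
Proof.
move=> fz; have q1 : (1 < q)%N := finNzRing_gt1 F.
have : root (\prod_(x : F) ('X - (iota x)%:P)) z.
  have -> : \prod_(x : F) ('X - (iota x)%:P) = map_poly iota ('X^q - 'X).
    rewrite finField_genPoly rmorph_prod.
    by apply: eq_bigr => x _; rewrite rmorphB /= map_polyX map_polyC.
  by rewrite rmorphB /= map_polyXn map_polyX rootE !hornerE -[z ^+ _]/(frobenius z) fz subrr.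
rewrite -big_enum -(big_map iota predT (fun c => 'X - c%:P)) root_prod_XsubC.
by case/mapP=> x _ ->; exists x.
Qed.

(* Frobenius permutes the roots of a characteristic polynomial over F, and the
   multiplicities m z are constant on orbits, so raising the product of all
   z^(m z) to the power q does not change it. *)
Lemma frobenius_telescope (I : finType) (s : I -> seq L) (e : I -> nat) :
  (forall v, perm_eq (map frobenius (s v)) (s v)) ->
  (forall v, 0 \notin s v) ->
  (forall z, (q.-1 %| \sum_v e v * count_mem z (s v))%N) ->
  \prod_v (\prod_(z <- s v) z) ^+ e v = 1.
Proof.
move=> fs s0 dvdz.
pose A := undup (flatten [seq s v | v : I]).
have sA v : {subset s v <= A}.
  move=> z zs; rewrite mem_undup; apply/flattenP; exists (s v) => //.
  by apply/mapP; exists v; rewrite ?mem_enum.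
have prodA v : \prod_(z <- s v) z = \prod_(z <- A) z ^+ count_mem z (s v).
  rewrite -prodr_undup_exp_count.
  rewrite [RHS](bigID (mem (s v))) /= [X in _ * X]big1 ?mulr1; last first.
    by move=> z /count_memPn ->.
  rewrite -[RHS]big_filter; apply: perm_big; apply: uniq_perm; rewrite ?filter_uniq ?undup_uniq //.
  by move=> z; rewrite mem_filter mem_undup; case: (boolP (z \in s v)) => //= /sA ->.
pose m z := ((\sum_v e v * count_mem z (s v)) %/ q.-1)%N.
have -> : \prod_v (\prod_(z <- s v) z) ^+ e v = \prod_(z <- A) z ^+ (m z * q.-1).
  under eq_bigr => v _ do rewrite prodA -prodrXl.
  rewrite exchange_big; apply: eq_bigr => z _ /=.
  rewrite divnK // -prodrXr; apply: eq_bigr => v _.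
  by rewrite -exprM mulnC.
have A0 : 0 \notin A.
  rewrite mem_undup; apply/flattenP => -[_ /mapP[v _ ->]]; exact/negP.
have E0 : \prod_(z <- A) z ^+ m z != 0.
  rewrite prodf_seq_neq0; apply/allP => z zA /=; rewrite expf_neq0 //.
  by apply: contraNneq A0 => <-.
apply: (mulfI E0); rewrite mulr1 -big_split /=.
have fm z : m (frobenius z) = m z.
  congr (_ %/ _)%N; apply: eq_bigr => v _; congr (_ * _)%N.
  have /seq.permP/(_ (pred1 (frobenius z))) <- := fs v.
  by rewrite count_map; apply: eq_count => x /=; rewrite (inj_eq (fmorph_inj frobenius)).
have fA : perm_eq (map frobenius A) A.
  have uA : uniq A := undup_uniq _.
  have ufA : uniq (map frobenius A) by rewrite map_inj_uniq //; apply: fmorph_inj.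
  apply: uniq_perm => //; apply: (uniq_min_size ufA _ _).2; rewrite ?size_map //.
  move=> _ /mapP[z zA ->]; move: zA; rewrite mem_undup => /flattenP[_ /mapP[v _ ->] zs].
  by apply: (sA v); rewrite -(perm_mem (fs v)) map_f.
rewrite -[in RHS](perm_big _ fA) big_map; apply: eq_bigr => z _.
rewrite fm /frobenius -exprM -exprD; congr (_ ^+ _).
by move: (finNzRing_gt1 F); case: q => // r _; rewrite mulnC mulSn.
Qed.

End Frobenius.

Lemma det_char_poly_prod (K : fieldType) n (A : 'M[K]_n) (s : seq K) :
  char_poly A = \prod_(z <- s) ('X - z%:P) -> \det A = \prod_(z <- s) z.
Proof.
move=> As; have sn : size s = n.
  have := congr1 (fun p : {poly K} => size p) As.
  by rewrite size_char_poly size_prod_XsubC => -[].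
have sg0 : (-1) ^+ n != 0 :> K by rewrite signr_eq0.
apply: (mulfI sg0); rewrite -char_poly_det As -horner_coef0 horner_prod.
under eq_bigr => z _ do rewrite hornerXsubC sub0r -mulN1r.
by rewrite big_split /= big_const_seq count_predT sn iter_mulr_1.
Qed.

Lemma geom_ext_hom (Q : quiver) (F : finFieldType) (d d' : dimvec Q)
    (M : rep F d) (N : rep F d') (g : dimhom F d d') :
  rep_hom M N g ->
  rep_hom (geom_ext M) (geom_ext N) (fun v => map_mx (to_alg_closure F) (g v)).
Proof. by move=> hg a; rewrite /geom_ext -!map_mxM hg. Qed.

(** Over the closure the generalized eigenspaces for one z form a direct summand of [geom_ext M],
    whose dimension at [v] is the multiplicity of z in the characteristic polynomial of [g v]. So
    the hypothesis on summands is the divisibility that [frobenius_telescope] asks for. *)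
Lemma prod_det_exp_eq1 (Q : quiver) (F : finFieldType) (d : dimvec Q)
    (M : rep F d) (e : vertex Q -> nat) (g : dimhom F d d) :
  (forall b (N : rep (alg_closure F) b), summand N (geom_ext M) ->
     (#|F|.-1 %| \sum_v e v * b v)%N) ->
  rep_hom M M g -> (forall v, g v \in unitmx) ->
  \prod_v \det (g v) ^+ e v = 1.
Proof.
set iota := to_alg_closure F => dvdM hg ug.
pose G v := map_mx iota (g v).
have /choice[s sE] v := char_poly_closed (G v).
apply: (fmorph_inj iota); rewrite rmorph1 rmorph_prod.
rewrite -[RHS](frobenius_telescope (s := s) (e := e)).
- apply: eq_bigr => v _.
  by rewrite rmorphXn -(det_char_poly_prod (sE v)) /G det_map_mx.
- move=> v; apply: prod_XsubC_eq; rewrite -sE big_map.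
  transitivity (map_poly (@frobenius F) (char_poly (G v))).
    by rewrite sE rmorph_prod; apply: eq_bigr => z _; rewrite rmorphB /= map_polyX map_polyC.
  rewrite map_char_poly; congr char_poly; apply/matrixP => i j.
  by rewrite !mxE; apply: frobenius_iota.
- move=> v; have := ug v; rewrite unitmxE unitfE; apply: contra => s0.
  rewrite -(fmorph_eq0 iota) -det_map_mx (det_char_poly_prod (sE v)).
  by rewrite (big_rem 0) //= mul0r.
move=> z; pose h v := G v - z%:M; have [N hN] := fitting h.
have hh : rep_hom (geom_ext M) (geom_ext M) h.
  apply: rep_homD; first exact: geom_ext_hom.
  exact/rep_homN/rep_hom_scalar.
have hhN := rep_hom_exp N.+1 hh.
have [|||v|M1 [M2 iso]] := @split_iso _ _ _ (geom_ext M)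
  (fun v => kermx ((h v : 'M_(d v)) ^+ N.+1)) (fun v => (h v : 'M_(d v)) ^+ N.+1).
- by move=> a; apply/sub_kermxP; rewrite -mulmxA hhN mulmxA mulmx_ker mul0mx.
- by move=> a; rewrite -hhN submxMl.
- by move=> v; have [] := hN v.
- by have [] := hN v.
have := dvdM _ M1 (summand_trans (summand_dsuml M1 M2) (summand_iso (rep_iso_sym iso))).
congr (_ %| _)%N; apply: eq_bigr => v _; congr (_ * _)%N.
by have [UW0 UW1] := hN v; apply: rank_geigenspace.
Qed.

(** * Linear characters of F^* *)

Section UnitCharacters.

Variable F : finFieldType.
Implicit Types phi : 'CF([set: {unit F}]).

(* Extension by 0 to F, which makes it multiplicative on all of F. *)
Definition unit_char phi (x : F) : algC := if insub x is Some u then phi u else 0.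

Lemma unit_char_val phi (u : {unit F}) : unit_char phi (val u) = phi u.
Proof. by rewrite /unit_char valK. Qed.

Lemma unit_charM phi : phi \is a linear_char -> {morph unit_char phi : x y / x * y}.
Proof.
move=> lphi x y; have [->|x0] := eqVneq x 0.
  by rewrite mul0r /unit_char insubF ?mul0r // unitr0.
have [->|y0] := eqVneq y 0.
  by rewrite mulr0 /unit_char insubF ?mulr0 // unitr0.
rewrite -unitfE in x0; rewrite -unitfE in y0.
rewrite -[x](insubdK (1%g : {unit F}) x0) -[y](insubdK (1%g : {unit F}) y0).
rewrite -FinRing.val_unitM !unit_char_val.
by rewrite lin_charM ?inE.
Qed.

Lemma unit_char1 phi : phi \is a linear_char -> unit_char phi 1 = 1.
Proof. by move=> lphi; rewrite -(FinRing.val_unit1 F) unit_char_val lin_char1. Qed.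

Lemma unit_generator : exists2 w : {unit F}, [set: {unit F}] = <[w]>%g & #[w]%g = #|F|.-1.
Proof.
have /cyclicP[w wE] := field_unit_group_cyclic [set: {unit F}]%G.
by exists w => //; rewrite -card_finField_unit wE.
Qed.

Lemma lin_char_eq1 phi (w : {unit F}) : [set: {unit F}] = <[w]>%g ->
  phi \is a linear_char -> phi w = 1 -> phi = 1.
Proof.
move=> wE lphi w1; apply/cfunP => u; rewrite cfun1E inE.
have /cycleP[i ->] : u \in <[w]>%g by rewrite -wE inE.
by rewrite lin_charX ?inE // w1 expr1n.
Qed.

Variables (Q : quiver) (sig : vertex Q -> 'CF([set: {unit F}])).
Hypothesis sig_lin : forall v, sig v \is a linear_char.

(** For the star quiver and [sigma] this is [sigma_pow]. *)
Definition char_pow (b : dimvec Q) : 'CF([set: {unit F}]) := \prod_v sig v ^+ b v.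

Lemma char_pow_lin b : char_pow b \is a linear_char.
Proof. by apply: rpred_prod => v _; apply: rpredX. Qed.

Lemma char_powE b u : char_pow b u = \prod_v sig v u ^+ b v.
Proof.
rewrite /char_pow; elim/big_rec2: _ => [|v x phi _ IH]; first by rewrite cfun1E inE.
by rewrite cfunE IH; congr (_ * _); elim: (b v) => [|n IHn];
  rewrite ?expr0 ?cfun1E ?inE // !exprS cfunE IHn.
Qed.

(** Discrete logarithms: with [sig v w = z ^+ e v] and [\det (g v) = w ^+ i v], the character value
    is 1 exactly if q-1 divides the sum of the [e v * i v], and this is read off from
    [prod_det_exp_eq1]. *)
Lemma det_char_trivial (d : dimvec Q) (M : rep F d) :
  (forall b (N : rep (alg_closure F) b), summand N (geom_ext M) -> char_pow b = 1) ->
  aut_trivial (fun v => unit_char (sig v)) M.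
Proof.
move=> sigM g hg ug.
have [w wE ow] := unit_generator.
have q1_gt0 : (0 < #|F|.-1)%N by rewrite -ow order_gt0.
have [z prim_z] := C_prim_root_exists q1_gt0.
have /choice[e eE] v : exists e, sig v w = z ^+ e.
  have [|i iE] := prim_rootP prim_z (x := sig v w); last by exists i.
  by rewrite -lin_charX ?inE // -ow expg_order lin_char1.
have /choice[u uE] v : exists u : {unit F}, val u = \det (g v).
  by exists (insubd (1%g : {unit F}) (\det (g v))); rewrite insubdK // -unitmxE.
have /choice[i iE] v : exists i, u v = (w ^+ i)%g.
  by apply/cycleP; rewrite -wE inE.
have dvdM b (N : rep (alg_closure F) b) : summand N (geom_ext M) ->
    (#|F|.-1 %| \sum_v e v * b v)%N.
  move=> /sigM/(congr1 (fun phi : 'CF(_) => phi w)); rewrite char_powE cfun1E inE.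
  under eq_bigr => v _ do rewrite eE -exprM.
  by rewrite prodrXr => /eqP; rewrite -(prim_order_dvd prim_z).
have := prod_det_exp_eq1 dvdM hg ug.
have -> : \prod_v \det (g v) ^+ e v = val (w ^+ (\sum_v i v * e v))%g.
  rewrite FinRing.val_unitX -prodrXr; apply: eq_bigr => v _.
  by rewrite -uE iE FinRing.val_unitX -exprM.
rewrite -(FinRing.val_unit1 F) => /val_inj/eqP; rewrite -order_dvdn ow => dvd.
have -> : det_char (fun v => unit_char (sig v)) g = z ^+ (\sum_v e v * i v).
  rewrite -prodrXr; apply: eq_bigr => v _.
  by rewrite -uE unit_char_val iE lin_charX ?inE // eE -exprM.
apply/eqP; rewrite -(prim_order_dvd prim_z).
by rewrite (eq_bigr (fun v => i v * e v)%N) // => v _; rewrite mulnC.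
Qed.

End UnitCharacters.

(** * Finite subfields of the algebraic closure *)

Section FiniteSubfield.

Variable F : finFieldType.
Local Notation L := (alg_closure F).
Local Notation toL := (to_alg_closure F).
Local Notation q := #|F|.

Lemma iter_frobenius j (z : L) : iter j (@frobenius F) z = z ^+ (q ^ j).
Proof.
by elim: j => [|j IH]; rewrite ?expr1 //= IH /frobenius -exprM expnSr.
Qed.

Lemma expr_card_inj j : injective (fun x : L => x ^+ (q ^ j)).
Proof.
move=> x y /=; rewrite -!iter_frobenius; elim: j => //= j IH.
by move/(fmorph_inj (@frobenius F)); apply: IH.
Qed.

Lemma expr_card_eq i j (z : L) : (i <= j)%N ->
  z ^+ (q ^ i) = z ^+ (q ^ j) -> z ^+ (q ^ (j - i)) = z.
Proof.
by move=> ij; rewrite -[in RHS](subnK ij) expnD exprM => /expr_card_inj.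
Qed.

Lemma root_expr_card (p : {poly F}) (z : L) j :
  root (map_poly toL p) z -> root (map_poly toL p) (z ^+ (q ^ j)).
Proof.
rewrite -iter_frobenius; elim: j => //= j IH /IH; move: (iter _ _ _) => y py.
have -> : map_poly toL p = map_poly (@frobenius F) (map_poly toL p).
  by apply/polyP => i; rewrite !coef_map /= frobenius_iota.
by rewrite fmorph_root.
Qed.

(** All z^(q^j) are roots of one nonzero polynomial over [F]. Its size [n] exceeds the number of its
    roots, so two of the first [n] coincide. *)
Lemma frobenius_periodic (z : L) : exists2 D, (0 < D)%N & z ^+ (q ^ D) = z.
Proof.
have [p mon_p pz] : integralOver toL z.
  exact: (svalP (tagged (countable_algebraic_closure F))).
have p0 : map_poly toL p != 0 by rewrite map_poly_eq0 monic_neq0.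
pose n := size (map_poly toL p).
have /injectivePn[i [j ij eij]] : ~~ injectiveb (fun j : 'I_n => z ^+ (q ^ j)).
  apply/negP => /injectiveP inj.
  have : (size [seq z ^+ (q ^ (j : 'I_n)) | j : 'I_n] < n)%N.
    apply: max_poly_roots p0 _ _; last by rewrite map_inj_uniq ?enum_uniq.
    by apply/allP => _ /mapP[j _ ->]; apply: root_expr_card.
  by rewrite size_map -cardE card_ord ltnn.
wlog lt_ij : i j ij eij / (i < j)%N.
  move=> W; have := ij; rewrite -val_eqE neq_ltn => /orP[lt|lt].
    exact: (W i j).
  by apply: (W j i); rewrite // eq_sym.
by exists (j - i)%N; rewrite ?subn_gt0 // expr_card_eq // ltnW.
Qed.

Lemma frobenius_periodic_mul D k (z : L) : z ^+ (q ^ D) = z -> z ^+ (q ^ (D * k)) = z.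
Proof.
move=> zD; elim: k => [|k IH]; first by rewrite muln0 expr1.
by rewrite mulnS expnD exprM zD.
Qed.

(** Finitely many elements lie in one finite field, the fixed field of a power of Frobenius. *)
Lemma frobenius_common_period (S : seq L) :
  exists2 D, (0 < D)%N & {in S, forall z, z ^+ (q ^ D) = z}.
Proof.
elim: S => [|z S [D D0 DS]]; first by exists 1%N.
have [D' D'0 zD'] := frobenius_periodic z; exists (D * D')%N; first by rewrite muln_gt0 D0.
move=> y; rewrite inE => /orP[/eqP->|yS].
  by rewrite mulnC frobenius_periodic_mul.
by rewrite frobenius_periodic_mul ?DS.
Qed.

(** [n] is -1 in the closure, so X^n - 1 is separable and has [n] distinct roots. *)
Lemma prim_root_alg_closure D : (0 < D)%N ->
  exists x : L, ((q ^ D).-1).-primitive_root x.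
Proof.
move=> D0; set n := (q ^ D).-1.
have q1 : (1 < q ^ D)%N by rewrite -{1}(exp1n D) ltn_exp2r // finNzRing_gt1.
have n0 : (0 < n)%N by rewrite /n; lia.
have nL : n%:R != 0 :> L.
  have -> : n%:R = -1 :> L.
    apply: (addIr 1); rewrite addNr natr1 /n prednK ?(ltnW q1) //.
    have -> : (q ^ D)%:R = toL (q%:R ^+ D) by rewrite rmorphXn rmorph_nat natrX.
    have -> : q%:R = 0 :> F by rewrite -FinRing.zmodXgE -cardsT expg_cardG ?inE.
    by rewrite expr0n gtn_eqF // rmorph0.
  by rewrite oppr_eq0 oner_neq0.
have [rs rsE] := closed_field_poly_normal ('X^n - 1 : {poly L}).
rewrite (monicP _) ?scale1r ?monicXnsubC // in rsE.
have /hasP[x _ prim_x] : has n.-primitive_root rs.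
  apply: has_prim_root => //.
  - apply/allP => z; rewrite -root_prod_XsubC -rsE rootE !hornerE.
    by rewrite unity_rootE subr_eq0.
  - by rewrite -separable_prod_XsubC -rsE; apply: separable_Xn_sub_1.
  have := congr1 (fun p : {poly L} => size p) rsE.
  by rewrite size_prod_XsubC size_XnsubC // => -[->].
by exists x.
Qed.

(** * The field K of order q^(D+1), whose unit group is generated by x *)

Section PrimitiveRoot.

Variables (D : nat) (x : L).
Hypothesis prim_x : ((q ^ D.+1).-1).-primitive_root x.

Lemma card_prim_root_neq0 : x != 0.
Proof. by rewrite (prim_root_eq0 prim_x) -lt0n (prim_order_gt0 prim_x). Qed.

Lemma prim_root_period : x ^+ (q ^ D.+1) = x.
Proof.
have q1 : (0 < q ^ D.+1)%N by rewrite expn_gt0 ltnW ?finNzRing_gt1.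
by rewrite -(prednK q1) exprS (prim_expr_order prim_x) mulr1.
Qed.

(** If two conjugates agreed, then x^(q^r) = x for some 0 < r <= D, and the order q^(D+1) - 1 of [x]
    would divide q^r - 1. *)
Lemma prim_root_conj_uniq : uniq [seq x ^+ (q ^ (i : 'I_D.+1)) | i : 'I_D.+1].
Proof.
rewrite map_inj_uniq ?enum_uniq //.
have lt_inj (i j : 'I_D.+1) : (i < j)%N -> x ^+ (q ^ i) <> x ^+ (q ^ j).
  move=> ij /(expr_card_eq (ltnW ij)) xr.
  have r0 : (0 < j - i)%N by rewrite subn_gt0.
  have rD : (j - i < D.+1)%N by apply: leq_ltn_trans (leq_subr _ _) _.
  move: (j - i)%N r0 rD xr => r r0 rD xr.
  have q1 : (1 < q)%N := finNzRing_gt1 F.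
  have qr1 : (1 < q ^ r)%N by rewrite -{1}(exp1n r) ltn_exp2r.
  have : ((q ^ D.+1).-1 %| (q ^ r).-1)%N.
    rewrite (prim_order_dvd prim_x); apply/eqP/(mulfI card_prim_root_neq0).
    by rewrite -exprS prednK ?(ltnW qr1) // mulr1.
  move/dvdn_leq; have : (q ^ r < q ^ D.+1)%N by rewrite ltn_exp2l.
  lia.
move=> i j /= eij; apply: val_inj; case: (ltngtP i j) => [ij|ji|//].
  by case: (lt_inj _ _ ij).
by case: (lt_inj _ _ ji).
Qed.

(** Frobenius permutes the conjugates of [x] cyclically, so it fixes the coefficients of the
    product, which therefore come from [F]. *)
Lemma prim_root_min_poly : exists2 f : {poly F}, size f = D.+2 /\ f \is monic &
  map_poly toL f = \prod_(i < D.+1) ('X - (x ^+ (q ^ i))%:P).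
Proof.
set g := \prod_(i < _) _.
have gfrob : map_poly (@frobenius F) g = g.
  rewrite rmorph_prod big_ord_recr /= [RHS]big_ord_recl /= mulrC; congr (_ * _).
    rewrite rmorphB /= map_polyX map_polyC /= /frobenius -exprM -expnSr.
    by rewrite prim_root_period expr1.
  apply: eq_bigr => i _; rewrite rmorphB /= map_polyX map_polyC /= /frobenius.
  by rewrite -exprM -expnSr.
have /choice[c cE] i : exists c, g`_i = toL c.
  by apply: frobenius_fixed; rewrite -[in RHS]gfrob coef_map.
pose f := \poly_(i < size g) c i.
have fE : map_poly toL f = g.
  apply/polyP => i; rewrite coef_map coef_poly; case: ltnP => [_|?]; first by rewrite [RHS]cE.
  by rewrite nth_default //; apply: (rmorph0 toL).
exists f => //; split.
  rewrite -(size_map_poly toL) fE /g (size_prod_XsubC _ (fun i : 'I_D.+1 => x ^+ (q ^ i))).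
  by rewrite /index_enum -enumT size_enum_ord.
rewrite -(map_monic toL) fE; exact: monic_prod_XsubC.
Qed.

(** This realises K inside the matrices over [F]: the first clause makes p(x) -> p(C) well defined,
    the second says that det C is the norm of [x]. Elements of K are handled through polynomials
    that represent them. *)
Lemma companion_matrix : exists C : 'M[F]_D.+1,
  [/\ forall p p' : {poly F}, (map_poly toL p).[x] = (map_poly toL p').[x] ->
        horner_mx C p = horner_mx C p' &
     toL (\det C) = \prod_(i < D.+1) x ^+ (q ^ i)].
Proof.
have [f [sf mon_f] fE] := prim_root_min_poly.
have [C CE] : exists C : 'M[F]_D.+1, char_poly C = f.
  suff : exists C : 'M[F]_((size f).-1), char_poly C = f by rewrite sf.
  by exists (companionmx f); apply: companionmxK.
exists C; split=> [p p' pp'|].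
  apply/eqP; rewrite -subr_eq0 -rmorphB; apply/eqP.
  have : f %| (p - p').
    rewrite -(dvdp_map toL) fE.
    rewrite -(big_map (fun i : 'I_D.+1 => x ^+ (q ^ i)) predT (fun z => 'X - z%:P)).
    apply: uniq_roots_dvdp; last by rewrite uniq_rootsE /index_enum -enumT prim_root_conj_uniq.
    apply/allP => _ /mapP[i _ ->]; apply: root_expr_card.
    by rewrite rootE rmorphB hornerD hornerN pp' subrr.
  case/dvdpP => u ->; rewrite -CE rmorphM.
  by rewrite /= Cayley_Hamilton mulr0.
rewrite -det_map_mx.
rewrite -(big_map (fun i : 'I_D.+1 => x ^+ (q ^ i)) predT id).
by apply: det_char_poly_prod; rewrite -map_char_poly CE fE big_map.
Qed.

(** The norm is the power of [x] with exponent 1 + q + ... + q^D, and q-1 times this exponent is the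
    order of [x]. *)
Lemma norm_generator (u : {unit F}) :
  toL (val u) = \prod_(i < D.+1) x ^+ (q ^ i) -> [set: {unit F}] = <[u]>%g.
Proof.
move=> uE; apply/esym/eqP; rewrite eqEcard subsetT card_finField_unit.
suff dvd j : (#[u]%g %| j)%N -> (q.-1 %| j)%N by rewrite dvdn_leq ?order_gt0 // dvd.
rewrite order_dvdn => /eqP/(congr1 (fun v => toL (val v))).
rewrite FinRing.val_unitX rmorphXn uE FinRing.val_unit1 rmorph1 prodrXr -exprM.
move/eqP; rewrite -(prim_order_dvd prim_x) predn_exp mulnC dvdn_pmul2l //.
by rewrite big_ord_recl addn_gt0 expn0.
Qed.

(** A nonzero [z] is a root of unity of order dividing that of [x], hence a power of [x], and a
    monomial represents it. *)
Lemma prim_root_poly (z : L) : z ^+ (q ^ D.+1) = z ->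
  exists p : {poly F}, (map_poly toL p).[x] = z.
Proof.
have q0 : (0 < q ^ D.+1)%N by rewrite expn_gt0 ltnW ?finNzRing_gt1.
have [->|z0] := eqVneq z 0; first by exists 0; rewrite rmorph0 horner0.
rewrite -(prednK q0) exprS => zz.
have [|i ->] := prim_rootP prim_x (x := z); last by exists 'X^i; rewrite map_polyXn hornerXn.
by apply: (mulfI z0); rewrite mulr1.
Qed.

End PrimitiveRoot.

End FiniteSubfield.

Lemma det_castmx (R : comNzRingType) m n (e : m = n) (A : 'M[R]_m) :
  \det (castmx (e, e) A) = \det A.
Proof. by case: n / e; rewrite castmx_id. Qed.

Lemma det_mxdiag (R : comNzRingType) n (p : 'I_n -> nat) (A : forall i, 'M[R]_(p i)) :
  \det (\mxdiag_i A i) = \prod_i \det (A i).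
Proof.
elim: n p A => [|n IH] p A.
  have det0 k (B : 'M[R]_k) : k = 0%N -> \det B = 1.
    by case: k B => // B _; rewrite det_mx00.
  by rewrite [RHS]big_ord0 det0 ?big_ord0.
by rewrite mxdiag_recl det_castmx det_ublock IH big_ord_recl.
Qed.

(** * Restriction of scalars from K to F *)

Section BlowUp.

Variables (F : fieldType) (D : nat) (C : 'M[F]_D.+1).

(** For [C] from [companion_matrix] this is restriction of scalars in coordinates, each polynomial
    standing for its value at [x]. *)
Definition blowup m n (A : 'M[{poly F}]_(m, n)) :
    'M[F]_(\sum_(i < m) D.+1, \sum_(j < n) D.+1) :=
  \mxblock_(i < m, j < n) horner_mx C (A i j).

Lemma blowupM m n p (A : 'M_(m, n)) (B : 'M_(n, p)) :
  blowup (A *m B) = blowup A *m blowup B.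
Proof.
rewrite /blowup mul_mxblock; apply/eq_mxblockP => i k.
by rewrite mxE rmorph_sum; apply: eq_bigr => j _; rewrite rmorphM.
Qed.

Lemma blowup_scalar n (p : {poly F}) :
  blowup (p%:M : 'M_n) = \mxdiag_(i < n) horner_mx C p.
Proof.
apply/eq_mxblockP => i j; rewrite mxE conform_mx_id.
by case: eqP => //; rewrite rmorph0.
Qed.

Lemma blowup1 n : blowup (1%:M : 'M_n) = 1%:M.
Proof. by rewrite blowup_scalar rmorph1 -[RHS]mxdiagZ. Qed.

Lemma det_blowup_scalar n (p : {poly F}) :
  \det (blowup (p%:M : 'M_n)) = \det (horner_mx C p) ^+ n.
Proof. by rewrite blowup_scalar det_mxdiag prodr_const card_ord. Qed.

(** On matrices over [F] the blow-up is a direct sum of [D.+1] copies; the copy with index [t]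
    consists of the coordinate [t] of every block. *)
Definition blowup_proj (t : 'I_D.+1) n : 'M[F]_(\sum_(i < n) D.+1, n) :=
  \mxcol_(i < n) delta_mx t i.

Definition blowup_incl (t : 'I_D.+1) n : 'M[F]_(n, \sum_(i < n) D.+1) :=
  \mxrow_(i < n) delta_mx i t.

Lemma blowup_projE t m n (A : 'M[F]_(m, n)) :
  blowup (map_mx polyC A) *m blowup_proj t n = blowup_proj t m *m A.
Proof.
rewrite /blowup mul_mxblock_mxrow mxcol_mul; apply/eq_mxcolP => i.
transitivity (\sum_j A i j *: delta_mx t j : 'M[F]_(D.+1, n)).
  by apply: eq_bigr => j _; rewrite mxE horner_mx_C mul_scalar_mx.
apply/matrixP => s c; rewrite summxE (bigD1 c) //= big1 ?addr0; last first.
  by move=> j jc; rewrite !mxE [c == j]eq_sym (negPf jc) andbF mulr0.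
rewrite !mxE (bigD1 i) //= big1 ?addr0; last first.
  by move=> j ji; rewrite !mxE (negPf ji) andbF mul0r.
by rewrite !mxE !eqxx !andbT; case: eqP; rewrite ?mulr1 ?mul1r ?mulr0 ?mul0r.
Qed.

Lemma blowup_inclE t m n (A : 'M[F]_(m, n)) :
  A *m blowup_incl t n = blowup_incl t m *m blowup (map_mx polyC A).
Proof.
rewrite /blowup mul_mxrow_mxblock mul_mxrow; apply/eq_mxrowP => j.
transitivity (\sum_i A i j *: delta_mx i t : 'M[F]_(m, D.+1)); last first.
  by apply: eq_bigr => i _; rewrite mxE horner_mx_C mul_mx_scalar.
apply/matrixP => c s; rewrite summxE [RHS](bigD1 c) //= big1 ?addr0; last first.
  by move=> i ic; rewrite !mxE [c == i]eq_sym (negPf ic) mulr0.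
rewrite !mxE (bigD1 j) //= big1 ?addr0; last first.
  by move=> i ij; rewrite !mxE (negPf ij) mulr0.
by rewrite !mxE !eqxx.
Qed.

Lemma blowup_proj_incl n :
  \sum_t blowup_proj t n *m blowup_incl t n = 1%:M.
Proof.
rewrite (eq_bigr (fun t => \mxblock_(i < n, j < n)
  (delta_mx t i *m delta_mx j t : 'M[F]_D.+1))); last first.
  by move=> t _; apply: mul_mxcol_mxrow.
rewrite -mxblock_sum -[RHS]mxdiagZ; apply/eq_mxblockP => i j.
rewrite conform_mx_id.
under eq_bigr => t _ do rewrite mul_delta_mx_cond.
case: eqP => _; last by rewrite big1.
by rewrite mx1_sum_delta.
Qed.

End BlowUp.

Lemma char_pow_summand (Q : quiver) (F : finFieldType)
    (sig : vertex Q -> 'CF([set: {unit F}])) (d b : dimvec Q) (M : rep F d)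
    (N : rep (alg_closure F) b) :
  (forall v, sig v \is a linear_char) ->
  aut_trivial (fun v => unit_char (sig v)) M -> summand N (geom_ext M) ->
  char_pow sig b = 1.
Proof.
set L := alg_closure F; set toL := to_alg_closure F.
move=> sig_lin trM [i [p [hi hp ip]]].
pose entries m n (A : 'M[L]_(m, n)) := [seq A rc.1 rc.2 | rc : 'I_m * 'I_n].
(* [N], [i] and [p] have finitely many entries, which lie in one finite field. *)
pose S := flatten [seq entries _ _ (N a) | a : arrow Q] ++
  flatten [seq entries _ _ (i v) ++ entries _ _ (p v) | v : vertex Q].
have [[//|D] _ SD] := frobenius_common_period S.
have [x prim_x] := prim_root_alg_closure F (ltn0Sn D).
have [C [CE detC]] := companion_matrix prim_x.
pose ev (P : {poly F}) : L := (map_poly toL P).[x].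
have evD P R : ev (P + R) = ev P + ev R by rewrite /ev rmorphD hornerD.
have evM P R : ev (P * R) = ev P * ev R by rewrite /ev rmorphM hornerM.
have evC c : ev c%:P = toL c by rewrite /ev map_polyC hornerC.
have ev_mul m n k (A : 'M_(m, n)) (B : 'M_(n, k)) :
    map_mx ev (A *m B) = map_mx ev A *m map_mx ev B.
  apply/matrixP => r c; rewrite !mxE (big_morph ev evD (id1 := 0)).
    by apply: eq_bigr => j _; rewrite evM !mxE.
  by rewrite /ev rmorph0 horner0.
have ev_polyC m n (A : 'M_(m, n)) : map_mx ev (map_mx polyC A) = map_mx toL A.
  by apply/matrixP => r c; rewrite !mxE evC.
have lift m n (A : 'M[L]_(m, n)) : {subset entries _ _ A <= S} ->
    exists B, map_mx ev B = A.
  move=> sA; have /choice[B BE] (rc : 'I_m * 'I_n) : exists P, ev P = A rc.1 rc.2.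
    by apply: (prim_root_poly prim_x); apply/SD/sA/mapP; exists rc; rewrite ?mem_enum.
  by exists (\matrix_(r, c) B (r, c)); apply/matrixP => r c; rewrite !mxE BE.
have liftN a : exists B, map_mx ev B = N a.
  apply: lift => z zN; rewrite mem_cat; apply/orP; left.
  by apply/flattenP; exists (entries _ _ (N a)) => //; apply/mapP; exists a; rewrite ?mem_enum.
have lift_ip v : exists B, map_mx ev B.1 = i v /\ map_mx ev B.2 = p v.
  have sv : {subset entries _ _ (i v) ++ entries _ _ (p v) <= S}.
    move=> z zv; rewrite mem_cat; apply/orP; right; apply/flattenP.
    by exists (entries _ _ (i v) ++ entries _ _ (p v)) => //; apply/mapP; exists v; rewrite ?mem_enum.
  have [|Bi BiE] := lift _ _ (i v); first by move=> z zi; rewrite sv // mem_cat zi.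
  have [|Bp BpE] := lift _ _ (p v); first by move=> z zp; rewrite sv // mem_cat zp orbT.
  by exists (Bi, Bp).
pose N' a := projT1 (cid (liftN a)).
pose i' v := (projT1 (cid (lift_ip v))).1; pose p' v := (projT1 (cid (lift_ip v))).2.
have N'E a : map_mx ev (N' a) = N a by rewrite /N'; case: cid.
have i'E v : map_mx ev (i' v) = i v by rewrite /i'; case: cid => ? [].
have p'E v : map_mx ev (p' v) = p v by rewrite /p'; case: cid => ? [].
(* The lifts [N'], [i'], [p'] satisfy the relations between [N], [i] and [p] only after evaluation
   at [x], but this is enough for their blow-ups. *)
have blowup_eq m n (A B : 'M_(m, n)) : map_mx ev A = map_mx ev B ->
    blowup C A = blowup C B.
  move=> AB; apply/eq_mxblockP => r c; apply: CE.
  by move/matrixP/(_ r c): AB; rewrite !mxE.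
pose X : rep F (fun v => \sum_(r < b v) D.+1)%N := fun a => blowup C (N' a).
pose MD : rep F (fun v => \sum_(r < d v) D.+1)%N :=
  fun a => blowup C (map_mx polyC (M a)).
have sX : summand X MD.
  exists (fun v => blowup C (i' v)), (fun v => blowup C (p' v)); split=> [a|a|v].
  - rewrite -!blowupM; apply: blowup_eq.
    by rewrite !ev_mul N'E !i'E ev_polyC; apply: hi.
  - rewrite -!blowupM; apply: blowup_eq.
    by rewrite !ev_mul N'E !p'E ev_polyC; apply: hp.
  rewrite -blowupM -[RHS](blowup1 C); apply: blowup_eq.
  rewrite ev_mul i'E p'E ip; apply/matrixP => r c; rewrite !mxE.
  by case: eqP => _; rewrite /ev ?rmorph1 ?hornerC ?rmorph0 ?horner0.
have addMD : add_closure MD M.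
  exists D.+1, (fun t v => blowup_proj F t (d v)), (fun t v => blowup_incl F t (d v)).
  split=> [t a|t a|v].
  - exact: blowup_projE.
  - exact: blowup_inclE.
  exact: blowup_proj_incl.
have chi1 v : unit_char (sig v) 1 = 1 by apply: unit_char1.
have chiM v : {morph unit_char (sig v) : y z / y * z} by apply: unit_charM.
have trX := aut_trivial_add_closure chi1 chiM (add_closure_summand sX addMD) trM.
have uC : \det C \is a GRing.unit.
  by rewrite unitfE -(fmorph_eq0 toL) detC prodrXr expf_neq0 ?(card_prim_root_neq0 prim_x).
pose w : {unit F} := insubd (1%g : {unit F}) (\det C).
have wE : val w = \det C by rewrite insubdK.
have detg v : \det (blowup C ('X%:M : 'M_(b v))) = val (w ^+ b v)%g.
  by rewrite det_blowup_scalar horner_mx_X -wE FinRing.val_unitX.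
(* Multiplication by [x] is an automorphism of [X]; its determinants are powers of the norm [w] of
   [x], with the dimensions [b v] as exponents. *)
have := trX (fun v => blowup C 'X%:M); rewrite /det_char.
under eq_bigr => v _ do rewrite detg unit_char_val lin_charX ?inE //.
rewrite -char_powE => triv; apply: (lin_char_eq1 (w := w)).
- by apply: (norm_generator prim_x); rewrite wE.
- exact: char_pow_lin.
apply: triv => [a|v]; first by rewrite /X -!blowupM scalar_mxC.
by rewrite unitmxE detg; case: (w ^+ b v)%g.
Qed.

(** * Choices along the legs, and injectivity of the arrows *)

Section Legs.

Variables (k : nat) (l : 'I_k -> nat).
Local Notation leg := (leg_vertex l).

Lemma leg_pred_inj (x x' y : leg) :
  leg_pred x = Some y -> leg_pred x' = Some y -> x = x'.
Proof.
case: x x' y => [i a] [i' a'] [i'' c]; rewrite /leg_pred /=.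
case: eqP => // /eqP; rewrite -lt0n => a0 [e1]; case: i'' / e1 c => c /eqP.
rewrite eq_Tagged /= => /eqP/(congr1 val) /= ac.
case: eqP => // /eqP; rewrite -lt0n => a'0 [e1]; case: i / e1 a a0 c ac => a a0 c ac /eqP.
rewrite eq_Tagged /= => /eqP/(congr1 val) /= a'c.
by congr (existT _ _ _); apply: val_inj; rewrite /= -(prednK a0) -(prednK a'0) ac a'c.
Qed.

Lemma leg_pred_None_inj (x x' : leg) :
  leg_pred x = None -> leg_pred x' = None -> tag x = tag x' -> x = x'.
Proof.
rewrite /leg_pred; case: eqP => // x0 _; case: eqP => // x'0 _.
case: x x0 x' x'0 => [i a] /= a0 [i' a'] /= a'0 ii'.
case: i' / ii' a' a'0 => a' a'0; congr (existT _ _ _); apply: val_inj.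
by rewrite /= a0 a'0.
Qed.

Definition depth (v : option leg) : nat := if v is Some x then (tagged x).+1 else 0.

Lemma depth_leg_pred (x : leg) : depth (leg_pred x) = tagged x.
Proof. by rewrite /leg_pred; case: eqP => [->|/eqP] //=; rewrite -lt0n => /prednK. Qed.

Lemma tag_leg_pred (x y : leg) : leg_pred x = Some y -> tag y = tag x.
Proof. by rewrite /leg_pred; case: eqP => // _ [<-]. Qed.

Lemma leg_ind (P : option leg -> Prop) :
  P None -> (forall x, P (leg_pred x) -> P (Some x)) -> forall v, P v.
Proof.
move=> P0 PS v; move: {2}(depth v) (erefl (depth v)) => n.
elim: n v => [|n IH] [x|] //= [xn]; apply: PS; apply: IH.
by rewrite depth_leg_pred.
Qed.

(* Dependent choice along the legs, from their outer ends towards the central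
   vertex; the values obtained there may differ from leg to leg. *)
Lemma leg_choice (T : option leg -> Type)
    (R : forall x : leg, T (Some x) -> T (leg_pred x) -> Prop) :
  (forall v, T v) ->
  (forall x t, exists t', R x t t') ->
  exists (G : forall x : leg, T (Some x)) (Z : 'I_k -> T None),
  forall x, R x (G x)
    (match leg_pred x as v return T v with Some y => G y | None => Z (tag x) end).
Proof.
move=> t0 step; pose S x t := projT1 (cid (step x t)).
have SP x t : R x t (S x t) by rewrite /S; case: cid.
pose next (G : forall x : leg, T (Some x)) (y : leg) : T (Some y) :=
  match pselect (exists x : leg, leg_pred x = Some y) with
  | left e => ecast v (T v) (projT2 (cid e)) (S _ (G (projT1 (cid e))))
  | right _ => t0 (Some y)
  end.
pose H := fix H n := if n is n'.+1 then next (H n') else (fun y => t0 (Some y)).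
(* The number of iterations is the number of vertices from [y] outwards, so that [G y] is computed
   from [G] at the next outer vertex. *)
pose G (y : leg) := H (l (tag y) - tagged y)%N y.
pose Z i : T None :=
  match pselect (exists x : leg, tag x = i /\ leg_pred x = None) with
  | left e => ecast v (T v) (projT2 (cid e)).2 (S _ (G (projT1 (cid e))))
  | right _ => t0 None
  end.
exists G, Z => x.
suff -> : (match leg_pred x as v return T v with Some y => G y | None => Z (tag x) end)
    = S x (G x) by exact: SP.
(* The type of the [match] depends on [leg_pred x]. For an arbitrary [v] in its place, the equation
   can be tested through casts. *)
have aux v (s : T v) : (forall e : v = None, ecast v (T v) e s = Z (tag x)) ->
    (forall y (e : v = Some y), ecast v (T v) e s = G y) ->
    (match v as v return T v with Some y => G y | None => Z (tag x) end) = s.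
  by case: v s => [y|] s H0 H1; [rewrite -(H1 y erefl)|rewrite -(H0 erefl)].
apply: aux => [e|y e].
  rewrite /Z; case: pselect => [e'|[]]; last by exists x.
  case: (cid e') => x' [/= tx' px'].
  have xx' : x = x' := leg_pred_None_inj e px' (esym tx').
  case: x' / xx' tx' px' => tx' px'; by rewrite (eq_irrelevance (proj2 _) e).
have ty := tag_leg_pred e; have dy := depth_leg_pred x; rewrite e /= in dy.
have -> : G y = next (H (l (tag x) - tagged x)%N) y.
  have lxy : l (tag y) = l (tag x) by rewrite ty.
  rewrite /G; have -> : (l (tag y) - tagged y = (l (tag x) - tagged x).+1)%N.
    have subE (A B c a : nat) : A = B -> c.+1 = a -> (a < B)%N -> (A - c = (B - a).+1)%N.
      lia.
    exact: subE lxy dy (ltn_ord _).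
  by [].
rewrite /next; case: pselect => [e'|[]]; last by exists x.
case: (cid e') => x' /= px'; have xx' := leg_pred_inj e px'.
case: x' / xx' px' => px'.
have irr (a b : leg_pred x = Some y) t : ecast v (T v) a t = ecast v (T v) b t.
  by rewrite (eq_irrelevance a b).
exact: irr.
Qed.

Section ToRoot.

Variables (K : fieldType) (d : dimvec (star l)) (M : rep K d).

(** [n] is fuel; [to_root] supplies the depth of [v], so the default 0 is never reached. *)
Fixpoint to_root_rec n (v : option leg) : 'M[K]_(d v, d None) :=
  match v with
  | None => 1%:M
  | Some x => if n is n'.+1 then M x *m to_root_rec n' (leg_pred x) else 0
  end.

Definition to_root (v : vertex (star l)) : 'M[K]_(d v, d None) :=
  to_root_rec (depth v) v.

Lemma to_rootS x : to_root (Some x) = M x *m to_root (leg_pred x).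
Proof. by rewrite /to_root depth_leg_pred. Qed.

Lemma to_root_free v : (forall x, row_free (M x)) -> row_free (to_root v).
Proof.
move=> freeM; elim/leg_ind: v => [|x IH].
  by rewrite row_free_unit unitmx1.
by rewrite to_rootS /row_free mxrankMfree ?[_ == _]freeM.
Qed.

Lemma to_root_complement : exists W : dimhom K d d,
  [/\ forall x : leg, (W (Some x) *m M x <= W (leg_pred x))%MS,
      forall v, (kermx (to_root v) :&: W v = 0)%MS &
      forall v, (1%:M <= kermx (to_root v) + W v)%MS].
Proof.
pose good v (W : 'M[K]_(d v)) := ((kermx (to_root v) :&: W = 0)%MS /\
  (1%:M <= kermx (to_root v) + W)%MS).
pose T v := {W : 'M[K]_(d v) | good v W}.
have goodC v (A : 'M[K]_(d v)) : (A :&: kermx (to_root v) = 0)%MS ->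
    good v (A + (A + kermx (to_root v))^C)%MS.
  set U := kermx _ => AU; split.
    apply/eqP/rowV0P => u; rewrite sub_capmx => /andP[uU].
    case/sub_addsmxP => -[ua uc] /= uE.
    have : (uc *m (A + U)^C <= (A + U) :&: (A + U)^C)%MS.
      rewrite sub_capmx submxMl andbT.
      have -> : uc *m (A + U)^C%MS = - (ua *m A) + u by rewrite uE addKr.
      by rewrite addmx_sub_adds // ?eqmx_opp ?submxMl.
    rewrite capmx_compl submx0 => /eqP c0; rewrite c0 addr0 in uE.
    by apply/eqP; rewrite -submx0 -AU sub_capmx uU uE submxMl.
  rewrite addsmxA [(U + A)%MS]addsmxC sub1mx.
  exact: addsmx_compl_full.
have t0 v : T v by apply: (exist _ _ (goodC v 0 _)); rewrite cap0mx.
pose R (x : leg) (t : T (Some x)) (t' : T (leg_pred x)) :=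
  (sval t *m M x <= sval t')%MS.
have step x t : exists t', R x t t'.
  case: t => W [UW0 UW1].
  have AU : (<<W *m M x>> :&: kermx (to_root (leg_pred x)) = 0)%MS.
    apply/eqP/rowV0P => u; rewrite sub_capmx genmxE => /andP[/submxP[w ->] /sub_kermxP wU].
    have : (w *m W <= kermx (to_root (Some x)) :&: W)%MS.
      rewrite sub_capmx submxMl andbT; apply/sub_kermxP.
      by rewrite to_rootS !mulmxA in wU *; rewrite -wU.
    by rewrite UW0 submx0 mulmxA => /eqP ->; rewrite mul0mx.
  exists (exist _ _ (goodC _ _ AU)); rewrite /R /=.
  by rewrite (submx_trans _ (addsmxSl _ _)) // genmxE.
have [G [Z GP]] := leg_choice t0 step.
pose W v : 'M[K]_(d v) := if v is Some x then sval (G x) else 1%:M.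
have K0 : kermx (to_root None) = 0.
  by apply/eqP; rewrite kermx_eq0 row_free_unit unitmx1.
exists W; split=> [x|[x|]|[x|]] /=.
- have := GP x; rewrite /R; move: (M x); rewrite /W /=.
  by case: (leg_pred x) => [y|] A //; rewrite submx1.
- by case: (G x) => ? [].
- by rewrite K0 cap0mx.
- by case: (G x) => ? [].
by rewrite addsmxSr.
Qed.

Lemma nonincreasing_root0 (b : dimvec (star l)) :
  nonincreasing b -> b None = 0%N -> forall v, b v = 0%N.
Proof.
move=> nb b0; elim/leg_ind => // x IH; apply/eqP; rewrite -leqn0 -IH.
exact: nb.
Qed.

Lemma nonincreasing_row_free :
  (forall b (N : rep K b), summand N M -> nonincreasing b) ->
  forall x, row_free (M x).
Proof.
move=> ninc x; have [W [sW UW0 UW1]] := to_root_complement.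
have sU (a : leg) : (kermx (to_root (Some a)) *m M a <= kermx (to_root (leg_pred a)))%MS.
  by apply/sub_kermxP; rewrite -mulmxA -to_rootS mulmx_ker.
have [M1 [M2 iso]] := @split_iso (star l) _ _ M (fun v => kermx (to_root v)) W sU sW UW0 UW1.
have nb := ninc _ M1 (summand_trans (summand_dsuml M1 M2) (summand_iso (rep_iso_sym iso))).
have : \rank (kermx (to_root (Some x))) = 0%N.
  apply: (nonincreasing_root0 nb); apply/eqP; rewrite mxrank_eq0 kermx_eq0.
  by rewrite row_free_unit unitmx1.
move/eqP; rewrite mxrank_eq0 kermx_eq0 to_rootS => /row_freeP[B].
by rewrite -mulmxA => MB; apply/row_freeP; exists (to_root (leg_pred x) *m B).
Qed.

Lemma summand_nonincreasing :
  (forall x, row_free (M x)) ->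
  forall b (N : rep K b), summand N M -> nonincreasing b.
Proof.
move=> freeM b N sN x; have := @summand_row_free (star l) K _ _ N M x sN (freeM x).
by move=> /eqP <-; apply: rank_leq_col.
Qed.

End ToRoot.

End Legs.

(** * The level condition in terms of injectivity and automorphisms *)

Section Level.

Variables (F : finFieldType) (k : nat) (l : 'I_k -> nat).
Variable delta : forall i : 'I_k, 'I_(l i).+1 -> 'CF([set: {unit F}]).
Hypothesis delta_lin : forall i j, @delta i j \is a linear_char.

Lemma sigma_lin v : sigma (@delta) v \is a linear_char.
Proof.
case: v => [x|] /=; last by apply: rpred_prod => i _; apply: delta_lin.
by apply: rpred_div; apply: delta_lin.
Qed.

(** [V] agrees with [Hstar] on nonzero vectors bounded by [d], and dimension vectors of summands are
    so bounded. Monotonicity and sigma^b = 1 are additive in b, so they reach all summands from the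
    indecomposable ones. Conversely, injectivity gives monotonicity, and [char_pow_summand] gives
    sigma^b = 1. *)
Lemma level_at_mostP (d : dimvec (star l)) (V : dimvec (star l) -> Prop)
    (M : rep F d) :
  is_of_level (@delta) d V ->
  level_at_most V M <->
  (forall x, row_free (M x)) /\
  aut_trivial (fun v => unit_char (sigma (@delta) v)) M.
Proof.
move=> levelV; split=> [levM | [freeM trM] b].
  have good b (N : rep (alg_closure F) b) : summand N (geom_ext M) ->
      nonincreasing b /\ char_pow (sigma (@delta)) b = 1.
    move: b N; apply: summand_ind => [b npos|b b1 b2 bD [ni1 s1] [ni2 s2]|b N indN sN].
    - have b0 v : b v = 0%N.
        by apply/eqP; rewrite -leqn0 leqNgt; apply/negP => bv; apply: npos; exists v.
      split=> [x|]; first by rewrite b0.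
      by rewrite /char_pow big1 // => v _; rewrite b0 expr0.
    - split=> [x|]; first by rewrite !bD leq_add ?ni1 ?ni2.
      rewrite -[1]mulr1 -{1}s1 -s2 /char_pow -big_split.
      by apply: eq_bigr => v _; rewrite bD exprD.
    have [c [N' iso]] := summand_compl sN.
    have Vb : V b by apply: levM; exists N, c, N'.
    have [|ni _ _ sp] := (levelV b).2; last by [].
    split=> // [|v]; first by have [] := indN.
    by rewrite (rep_iso_dim v iso) leq_addr.
  split.
    move=> x; have := @nonincreasing_row_free _ _ _ _ (geom_ext M) (fun b N sN => (good b N sN).1) x.
    by rewrite /row_free /geom_ext mxrank_map.
  apply: (det_char_trivial sigma_lin) => b N sN; exact: (good b N sN).2.
move=> [N [c [N' [indN iso]]]].
have sN : summand N (geom_ext M).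
  exact: summand_trans (summand_dsuml N N') (summand_iso (rep_iso_sym iso)).
have [|//] := (levelV b).1; split.
- apply: (summand_nonincreasing _ sN) => x.
  by rewrite /row_free /geom_ext mxrank_map; apply: freeM.
- by have [] := indN.
- by move=> v; rewrite (rep_iso_dim v iso) leq_addr.
exact: (char_pow_summand sigma_lin trM sN).
Qed.

End Level.

(** * Standard flags and the matrices that preserve them *)

Section CoordinateFlags.

Variable F : fieldType.

(* The last a vectors of the standard basis of F^b, when a <= b. *)
Definition last_rows a b : 'M[F]_(a, b) :=
  \matrix_(r < a, c < b) (c == (b - a) + r :> nat)%N%:R.

Lemma last_rows_id a : last_rows a a = 1%:M.
Proof.
by apply/matrixP => r c; rewrite !mxE subnn add0n eq_sym.
Qed.

Lemma last_rowsE a b p (A : 'M[F]_(b, p)) (r : 'I_a) (r' : 'I_b) c :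
  r' = (b - a + r)%N :> nat -> (last_rows a b *m A) r c = A r' c.
Proof.
move=> r'E; rewrite mxE (bigD1 r') //= big1 ?addr0; last first.
  move=> j jr'; rewrite mxE (_ : _ == _ = false) ?mul0r //.
  by apply: contraNF jr'; rewrite -r'E -val_eqE.
by rewrite mxE r'E eqxx mul1r.
Qed.

Lemma mul_last_rows a b c : (a <= b)%N -> (b <= c)%N ->
  last_rows a b *m last_rows b c = last_rows a c.
Proof.
move=> ab bc; apply/matrixP => r j.
have rb : (b - a + r < b)%N by have := ltn_ord r; lia.
rewrite (last_rowsE _ _ (r' := Ordinal rb)) // !mxE /=; congr (_ == _)%:R; lia.
Qed.

Lemma last_rows_trK a b : (a <= b)%N -> last_rows a b *m (last_rows a b)^T = 1%:M.
Proof.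
move=> ab; apply/matrixP => r j.
have rb : (b - a + r < b)%N by have := ltn_ord r; lia.
rewrite (last_rowsE _ _ (r' := Ordinal rb)) // !mxE /= eqn_add2l.
by rewrite val_eqE.
Qed.

Lemma last_rows_free a b : (a <= b)%N -> row_free (last_rows a b).
Proof. by move=> ab; apply/row_freeP; exists (last_rows a b)^T; apply: last_rows_trK. Qed.

(** The lower right block of size [a]: the action of [A] on the span of the last [a] basis vectors
    when [A] preserves it. *)
Definition corner a b (A : 'M[F]_b) : 'M[F]_a :=
  last_rows a b *m A *m (last_rows a b)^T.

Lemma cornerE a b (A : 'M[F]_b) (r c : 'I_a) (r' c' : 'I_b) :
  r' = (b - a + r)%N :> nat -> c' = (b - a + c)%N :> nat -> corner a A r c = A r' c'.
Proof.
move=> r'E c'E; rewrite /corner -mulmxA (last_rowsE _ _ r'E) -[A *m _]trmxK.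
by rewrite trmx_mul trmxK mxE (last_rowsE _ _ c'E) mxE.
Qed.

Lemma last_rows_stableP a b (A : 'M[F]_b) : (a <= b)%N ->
  (last_rows a b *m A = corner a A *m last_rows a b) <->
  (forall r c : 'I_b, (b - a <= r)%N -> (c < b - a)%N -> A r c = 0).
Proof.
move=> ab; split=> [stab r c ar ca|A0].
  have ra : (r - (b - a) < a)%N by have := ltn_ord r; lia.
  move/matrixP/(_ (Ordinal ra) c): stab.
  rewrite (last_rowsE _ _ (r' := r)) /=; last by lia.
  by move=> ->; rewrite mxE big1 // => j _; rewrite [last_rows _ _ _ _]mxE ltn_eqF ?mulr0 //; lia.
apply/matrixP => r c.
have rb : (b - a + r < b)%N by have := ltn_ord r; lia.
rewrite (last_rowsE _ _ (r' := Ordinal rb)) // [RHS]mxE.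
have [ca|ac] := ltnP c (b - a).
  rewrite A0 /=; [|lia|by []].
  by rewrite big1 // => j _; rewrite [last_rows _ _ _ _]mxE ltn_eqF ?mulr0 //; lia.
have ca : (c - (b - a) < a)%N by have := ltn_ord c; lia.
rewrite (bigD1 (Ordinal ca)) //= big1 ?addr0; last first.
  move=> j jc; rewrite [last_rows _ _ _ _]mxE (_ : _ == _ = false) ?mulr0 //.
  by apply: contraNF jc; rewrite -val_eqE /= => /eqP ->; apply/eqP; lia.
rewrite [last_rows _ _ _ _]mxE (_ : _ == _ :> nat) ?mulr1 //=; last by apply/eqP; lia.
by rewrite (cornerE _ (r' := Ordinal rb) (c' := c)) //=; lia.
Qed.

Lemma det_ublock_ord a s b (e : (s + b)%N = a) (A : 'M[F]_a) :
  (forall (r : 'I_b) (c : 'I_s),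
    A (cast_ord e (rshift s r)) (cast_ord e (lshift b c)) = 0) ->
  \det A = \det (\matrix_(r < s, c < s) A (cast_ord e (lshift b r)) (cast_ord e (lshift b c)))
    * \det (\matrix_(r < b, c < b) A (cast_ord e (rshift s r)) (cast_ord e (rshift s c))).
Proof.
case: a / e A => A A0.
have dl0 : dlsubmx A = 0.
  by apply/matrixP => r c; rewrite !mxE -[RHS](A0 r c) !cast_ord_id.
rewrite -{1}[A]submxK dl0 det_ublock; congr (_ * _); congr determinant;
  by apply/matrixP => r c; rewrite !mxE !cast_ord_id.
Qed.

(** The rank factorisation of [X] has a factor [L] on the left. Since [X] has full row rank, [L] can
    be moved to the right as a diagonal block, and [Z] undoes it there. *)
Lemma row_free_pid a b (X : 'M[F]_(a, b)) : row_free X ->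
  exists2 u, u \in unitmx & X *m u = pid_mx a.
Proof.
move=> freeX; have ab : (a <= b)%N by rewrite -(eqP freeX) rank_leq_col.
have [c bE] : exists c, (a + c = b)%N by exists (b - a)%N; rewrite subnKC.
case: b / bE X freeX {ab} => X freeX.
have uL := col_ebase_unit X; set L := col_ebase X in uL.
pose Z := block_mx (invmx L) 0 0 (1%:M : 'M_c).
exists (invmx (row_ebase X) *m Z).
  rewrite unitmx_mul unitmx_inv row_ebase_unit unitmxE det_ublock det1 mulr1 -unitmxE.
  by rewrite unitmx_inv.
rewrite mulmxA -{1}[X]mulmx_ebase mulmxK ?row_ebase_unit // -/L.
rewrite (eqP freeX) pid_mx_row mul_mx_row mulmx1 mulmx0 mul_row_block.
by rewrite mulmxV // !mulmx0 !mul0mx !addr0.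
Qed.

Lemma row_free_extend a b (A B : 'M[F]_(a, b)) : row_free A -> row_free B ->
  exists2 u, u \in unitmx & A *m u = B.
Proof.
move=> /row_free_pid[u uu Au] /row_free_pid[w uw Bw]; exists (u *m invmx w).
  by rewrite unitmx_mul uu unitmx_inv.
by rewrite mulmxA Au -Bw mulmxK.
Qed.

End CoordinateFlags.

(** * Parabolic subgroups and their inflated characters *)

Section ParabolicCorners.

Variables (F : finFieldType) (n s : nat) (m : 'I_s.+1 -> nat).
Hypothesis e : (\sum_j m j = n.+1)%N.

Local Notation B g := (blk e (GLval g)).

Definition block_offset t := (\sum_(h < s.+1 | (h < t)%N) m h)%N.

Lemma block_offset_le t : (block_offset t <= n.+1)%N.
Proof. by rewrite -e [X in (_ <= X)%N](bigID (fun h : 'I_s.+1 => (h < t)%N)) leq_addr. Qed.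

Lemma block_offset_mono t t' : (t <= t')%N -> (block_offset t <= block_offset t')%N.
Proof.
move=> tt'; rewrite /block_offset [X in (_ <= X)%N](bigID (fun h : 'I_s.+1 => (h < t)%N)) /=.
rewrite [X in (_ <= X + _)%N](eq_bigl (fun h : 'I_s.+1 => (h < t)%N)) ?leq_addr // => h.
by case: (ltnP h t) => ht; rewrite ?andbF // (leq_trans ht tt').
Qed.

Lemma block_offsetS (t : 'I_s.+1) : block_offset t.+1 = (block_offset t + m t)%N.
Proof.
rewrite /block_offset (bigD1 t) //= addnC; congr (_ + _)%N.
by apply: eq_bigl => h; rewrite ltnS -val_eqE; case: ltngtP.
Qed.

Lemma block_offset0 : block_offset 0 = 0%N.
Proof. exact: big_pred0_eq. Qed.

Lemma block_offset_max : block_offset s.+1 = n.+1.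
Proof. by rewrite -e; apply: eq_bigl => h; rewrite ltn_ord. Qed.

Definition block_index (i : 'I_s.+1) (a : 'I_(m i)) : 'I_n.+1 :=
  cast_ord e (tagnat.Rank i a).

Lemma block_indexE i a : @block_index i a = (block_offset i + a)%N :> nat.
Proof. exact: tagnat.RankEsum. Qed.

Lemma block_index_surj (r : 'I_n.+1) : exists i a, r = @block_index i a.
Proof.
pose r' := cast_ord (esym e) r.
exists (tagnat.sig1 r'), (tagnat.sig2 r'); apply: val_inj.
by rewrite /= [LHS](congr1 val (esym (tagnat.sig2K r'))).
Qed.

Lemma blkE R (A : 'M[R]_n.+1) i j (a : 'I_(m i)) (b : 'I_(m j)) :
  blk e A i j a b = A (block_index a) (block_index b).
Proof.
rewrite /blk mxE castmxE.
by congr (A _ _); apply: val_inj.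
Qed.

(** Matrices act on row vectors from the right, so the block upper triangular ones are those that
    preserve the spans of the last basis vectors. The step with index [j] omits the first [j.+1]
    blocks; its dimension is that of alpha at [i, j+1]. *)
Lemma parabolic_cornerP (g : {'GL_n.+1[F]}) :
  reflect (forall j : nat, (j < s)%N ->
     let a := (n.+1 - block_offset j.+1)%N in
     last_rows F a n.+1 *m GLval g = corner a (GLval g) *m last_rows F a n.+1)
  (g \in parabolic_set F e).
Proof.
apply: (iffP (parabolicP e g)) => [Pg j js a | stab i j ji].
  apply/last_rows_stableP; rewrite ?leq_subr // subKn ?block_offset_le // => r c.
  have [i [x ->]] := block_index_surj r; have [i' [y ->]] := block_index_surj c.
  rewrite !block_indexE => jr cj; rewrite -blkE Pg ?mxE //.
  have ij : (j < i)%N.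
    rewrite ltnNge; apply/negP => ij.
    have := block_offset_mono (t := i.+1) (t' := j.+1) ij; rewrite block_offsetS.
    by have := ltn_ord x; lia.
  have i'j : (i' <= j)%N.
    rewrite leqNgt; apply/negP => ij'.
    by have := block_offset_mono ij'; lia.
  exact: leq_ltn_trans i'j ij.
apply/matrixP => x y; rewrite blkE mxE.
have js : (j < s)%N by have := ltn_ord i; lia.
have := (last_rows_stableP (GLval g) (leq_subr _ n.+1)).1 (stab j js).
rewrite subKn ?block_offset_le //; apply.
  by rewrite block_indexE; have := block_offset_mono ji; lia.
by rewrite block_indexE block_offsetS ltn_add2l.
Qed.

Lemma det_corner_parabolic (g : {'GL_n.+1[F]}) (t : 'I_s.+1) :
  g \in parabolic_set F e ->
  \det (corner (n.+1 - block_offset t) (GLval g)) =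
  \det (B g t t) * \det (corner (n.+1 - block_offset t.+1) (GLval g)).
Proof.
move=> Pg; have tS := block_offsetS t; have le := block_offset_le t.+1.
have E : (m t + (n.+1 - block_offset t.+1) = n.+1 - block_offset t)%N by lia.
have bS (r : 'I_(n.+1 - block_offset t.+1)) : (block_offset t + (m t + r) < n.+1)%N.
  by have := ltn_ord r; lia.
rewrite (det_ublock_ord (e := E)) => [|r c].
  congr (_ * _); congr determinant; apply/matrixP => r c; rewrite mxE.
    rewrite blkE; apply: cornerE; rewrite block_indexE /=; lia.
  rewrite (cornerE _ (r' := Ordinal (bS r)) (c' := Ordinal (bS c))) /=; try lia.
  by rewrite (cornerE _ (r' := Ordinal (bS r)) (c' := Ordinal (bS c))) //=; lia.
rewrite (_ : corner _ _ _ _ = GLval g (Ordinal (bS r)) (block_index c)); last first.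
  by apply: cornerE; rewrite ?block_indexE /=; lia.
have ts : (t < s)%N.
  rewrite ltnNge; apply/negP => st; have tE : t = s :> nat.
    by apply/eqP; rewrite eqn_leq st -ltnS ltn_ord.
  have offE : block_offset t.+1 = n.+1 by rewrite tE block_offset_max.
  by have := ltn_ord r; lia.
have := (last_rows_stableP (GLval g) (leq_subr _ n.+1)).1
  (parabolic_cornerP g Pg t ts).
rewrite subKn ?block_offset_le //; apply; first by rewrite /=; lia.
by rewrite block_indexE; have := ltn_ord c; lia.
Qed.

Variable delta : 'I_s.+1 -> 'CF([set: {unit F}]).
Hypothesis delta_lin : forall j, delta j \is a linear_char.

Definition inflated_char := cfSdprod (parabolic_sdprod F e) (levi_char e delta).

Lemma inflated_char_lin : inflated_char \is a linear_char.
Proof. by rewrite cfSdprod_lin_char; apply: levi_char_lin. Qed.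

Lemma inflated_charE (p : {'GL_n.+1[F]}) : p \in parabolic F e ->
  inflated_char p = \prod_j unit_char (delta j) (\det (B p j j)).
Proof.
move=> Pp; have [q Lq qE] := levi_part Pp.
have Pq : q \in parabolic F e := subsetP (levi_sub_parabolic F e) q Lq.
rewrite -(mulgKV q p) cfSdprodE //; last first.
  apply/unipotentP; split=> [|j]; first by rewrite groupM ?groupV.
  rewrite parabolic_blkM ?groupV // -qE -parabolic_blkM ?groupV //.
  by rewrite mulgV; apply: blk1.
rewrite levi_charE //; apply: eq_bigr => j _.
by rewrite mulgKV -unit_char_val levi_detE // qE.
Qed.

Lemma unit_char_div (phi psi : 'CF([set: {unit F}])) (x : F) :
  psi \is a linear_char -> x != 0 ->
  unit_char (phi / psi)%R x = unit_char phi x / unit_char psi x.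
Proof.
move=> lpsi; rewrite -unitfE => ux.
rewrite -[x](insubdK (1%g : {unit F}) ux) !unit_char_val cfunE; congr (_ * _).
set u := insubd _ _; have psi_u : psi u != 0 by rewrite lin_char_neq0 ?inE.
have : (psi * psi^-1) u = 1 by rewrite divrr ?lin_char_unitr // cfun1E inE.
by rewrite cfunE => psiV; apply: (mulfI psi_u); rewrite psiV divff.
Qed.

Lemma unit_char_neq0 (phi : 'CF([set: {unit F}])) (x : F) :
  phi \is a linear_char -> x != 0 -> unit_char phi x != 0.
Proof.
move=> lphi; rewrite -unitfE => ux.
by rewrite -[x](insubdK (1%g : {unit F}) ux) unit_char_val lin_char_neq0 ?inE.
Qed.

Lemma det_corner_full a b (A : 'M[F]_b) : a = b -> \det (corner a A) = \det A.
Proof. by move=> ->; rewrite /corner last_rows_id mul1mx trmx1 mulmx1. Qed.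

(** Summation by parts. With [D t] the determinant of the corner from block [t] on, block [t]
    contributes [delta t] at [D t / D t.+1]; collecting the characters at each [D t] produces the
    quotients that define [sigma]. The empty corner has [D s.+1 = 1]. *)
Lemma inflated_char_corner (p : {'GL_n.+1[F]}) : p \in parabolic F e ->
  inflated_char p = unit_char (delta ord0) (\det (GLval p)) *
  \prod_(j < s) unit_char (delta (lift ord0 j) / delta (widen_ord (leqnSn _) j))%R
    (\det (corner (n.+1 - block_offset j.+1) (GLval p))).
Proof.
move=> Pp; rewrite inflated_charE //.
pose D t := \det (corner (n.+1 - block_offset t) (GLval p)).
have D0 : D 0%N = \det (GLval p).
  by rewrite /D det_corner_full // block_offset0 subn0.
have Dmax : D s.+1 = 1.
  rewrite /D; move: (corner _ _); rewrite block_offset_max subnn => A.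
  exact: det_mx00.
have DS (t : 'I_s.+1) : D t = \det (B p t t) * D t.+1 by apply: det_corner_parabolic.
have Dn0 t : (t <= s.+1)%N -> D t != 0.
  elim: t => [|t IH] ts; first by rewrite D0 -unitfE -unitmxE GL_unitmx.
  by have := IH (ltnW ts); rewrite (DS (Ordinal ts)) mulf_eq0 negb_or => /andP[].
rewrite (eq_bigr (fun t : 'I_s.+1 => unit_char (delta t) (D t) / unit_char (delta t) (D t.+1))).
  rewrite big_split /= prodfV big_ord_recl D0 -mulrA; congr (_ * _).
  rewrite [X in _ / X]big_ord_recr /= Dmax unit_char1 // mulr1 -prodfV -big_split.
  by apply: eq_bigr => j _; rewrite unit_char_div // Dn0 // ltnS ltnW.
move=> t _; have nz : unit_char (delta t) (D t.+1) != 0 by rewrite unit_char_neq0 ?Dn0.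
by apply: (mulIf nz); rewrite divfK // -unit_charM // -DS.
Qed.

End ParabolicCorners.

(** * Mackey's formula as a weighted count of tuples *)

Section Transporter.

Variables (gT : finGroupType) (I : finType) (P : I -> {group gT}).
Implicit Types (f : I -> gT) (g : gT).

(* The elements mapping the coset f' i P i to f i P i for every i. *)
Definition transporter f f' : {set gT} :=
  [set g | [forall i, ((f i)^-1 * g * f' i)%g \in P i]].

Local Notation T := transporter.

Lemma transporterP f f' g :
  reflect (forall i, ((f i)^-1 * g * f' i)%g \in P i) (g \in T f f').
Proof. by rewrite inE; apply: forallP. Qed.

Lemma transporterV f f' g : (g^-1 \in T f' f)%g = (g \in T f f').
Proof.
by rewrite !inE; apply: eq_forallb => i; rewrite -groupV !invMg !invgK mulgA.
Qed.

Lemma transporterM f1 f2 f3 g g' :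
  g \in T f1 f2 -> g' \in T f2 f3 -> (g * g')%g \in T f1 f3.
Proof.
move=> /transporterP Tg /transporterP Tg'; apply/transporterP => i.
by have := groupM (Tg i) (Tg' i); rewrite !mulgA mulgK.
Qed.

Lemma card_transporter f f' g : g \in T f f' -> #|T f f'| = #|T f' f'|.
Proof.
move=> Tg; rewrite -(card_imset (mem (T f' f')) (mulgI g)); apply: eq_card => x.
apply/idP/imsetP => [Tx|[y Ty ->]]; last exact: transporterM Ty.
exists (g^-1 * x)%g; last by rewrite mulKVg.
by apply: transporterM Tx; rewrite transporterV.
Qed.

(* So the classes of the relation T f f' <> set0 all have the same total weight
   when f' is weighted by #|T f f'| = #|T f' f'|. *)
Lemma sum_card_transporter f :
  (\sum_(f' : {ffun I -> gT}) #|T f f'| = #|gT| * \prod_i #|P i|)%N.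
Proof.
transitivity (\sum_(g : gT) \sum_(f' : {ffun I -> gT}) (g \in T f f'))%N.
  by rewrite exchange_big; apply: eq_bigr => f' _; rewrite -sum1_card big_mkcond.
rewrite -sum_nat_const; apply: eq_bigr => g _.
rewrite -big_mkcond sum1_card /=.
rewrite (eq_card (B := family (fun i => mem ((g^-1 * f i) *: P i)%g))).
  by rewrite card_family foldrE big_map enumT; apply: eq_bigr => i _; apply: card_lcoset.
move=> f'; apply/transporterP/familyP => H i; have := H i.
  by rewrite /= mem_lcoset invMg invgK.
by rewrite /= mem_lcoset invMg invgK.
Qed.

Variable lam : forall i, 'CF(P i).
Hypothesis lam_lin : forall i, lam i \is a linear_char.

Definition stab_char f g : algC := \prod_i lam i (g ^ f i)%g.

Lemma stab_char_out f g : g \notin T f f -> stab_char f g = 0.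
Proof.
rewrite inE negb_forall => /existsP[i Pi].
by rewrite /stab_char (bigD1 i) //= cfun0 ?mul0r // conjgE mulgA.
Qed.

Lemma stab_charM f g g' : g \in T f f -> g' \in T f f ->
  stab_char f (g * g')%g = stab_char f g * stab_char f g'.
Proof.
move=> /transporterP Tg /transporterP Tg'; rewrite /stab_char -big_split.
by apply: eq_bigr => i _; rewrite conjMg lin_charM ?lam_lin // conjgE mulgA.
Qed.

Definition stab_trivial f : bool := [forall (g | g \in T f f), stab_char f g == 1].

(** [stab_char f] is a linear character of the group [T f f] extended by 0: translation by an
    element where it is not 1 shows that the sum vanishes. *)
Lemma sum_stab_char f :
  \sum_g stab_char f g = if stab_trivial f then #|T f f|%:R else 0.
Proof.
rewrite (bigID (mem (T f f))) /= [X in _ + X]big1 ?addr0; last first.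
  by move=> g; apply: stab_char_out.
case: ifP => [/forall_inP tr|/negbT].
  by rewrite (eq_bigr (fun=> 1)) ?sumr_const // => g /tr/eqP.
rewrite negb_forall => /existsP[g]; rewrite negb_imply => /andP[Tg g1].
set S := \sum_(_ | _) _; have : stab_char f g * S = S.
  rewrite /S mulr_sumr [RHS](reindex_inj (mulgI g)) /=.
  apply: eq_big => [g'|g' Tg']; last by rewrite stab_charM.
  apply/idP/idP => [|Tgg']; first exact: transporterM.
  by rewrite -(mulKg g g'); apply: transporterM Tgg'; rewrite transporterV.
move/eqP; rewrite -subr_eq0 -{2}[S]mul1r -mulrBl mulf_eq0 subr_eq0 (negPf g1) /=.
by move/eqP.
Qed.

(** Multiplying out the induction formulas gives one sum over tuples [f], and summing over the group
    first leaves the stabilizers. Each tuple of cosets comes from as many [f] as the product of the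
    [#|P i|]. *)
Lemma cfdot_prod_Ind :
  '[\prod_i 'Ind[[set: gT]] (lam i), 1] =
  (\sum_(f : {ffun I -> gT} | stab_trivial f) #|T f f|)%:R
    / (#|gT| * \prod_i #|P i|)%:R.
Proof.
have IndE g : (\prod_i 'Ind[[set: gT]] (lam i)) g =
    (\prod_i #|P i|%:R)^-1 * \sum_(f : {ffun I -> gT}) stab_char f g.
  rewrite prod_cfunE ?inE // -prodfV.
  rewrite (eq_bigr (fun i => #|P i|%:R^-1 * \sum_(y : gT) lam i (g ^ y)%g)); last first.
    by move=> i _; rewrite cfIndE ?subsetT //; congr (_ * _); apply: eq_bigl => y; rewrite inE.
  by rewrite big_split bigA_distr_bigA.
rewrite cfdotE cardsT natrM invfM mulrCA; congr (_ * _).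
rewrite (eq_bigr (fun g => (\prod_i #|P i|%:R)^-1 * \sum_(f : {ffun I -> gT}) stab_char f g)).
  rewrite -mulr_sumr mulrC natr_prod; congr (_ * _).
  rewrite (eq_bigl xpredT) => [|g]; last by rewrite inE.
  rewrite exchange_big /= natr_sum [RHS]big_mkcond.
  by apply: eq_bigr => f _; rewrite sum_stab_char.
by move=> g _; rewrite IndE cfun1E inE conjC1 mulr1.
Qed.

End Transporter.

(** * Tuples of flags as injective representations *)

Section HomToRoot.

Variables (k : nat) (l : 'I_k -> nat) (K : fieldType).
Variables (d d' : dimvec (star l)) (M : rep K d) (N : rep K d').

Lemma rep_hom_to_root (h : dimhom K d d') : rep_hom M N h ->
  forall v, to_root M v *m h None = h v *m to_root N v.
Proof.
move=> hh; elim/leg_ind => [|x IH]; first by rewrite mul1mx mulmx1.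
by rewrite !to_rootS -mulmxA IH !mulmxA -(hh x).
Qed.

(** The maps of [N] to the central vertex are injective, so commutation with an arrow can be tested
    after composing with them. *)
Lemma to_root_rep_hom (h : dimhom K d d') :
  (forall x : leg_vertex l, row_free (N x)) ->
  (forall v, to_root M v *m h None = h v *m to_root N v) -> rep_hom M N h.
Proof.
move=> freeN hE x; apply: (row_free_inj (to_root_free (leg_pred x) freeN)).
by rewrite -mulmxA -hE mulmxA -to_rootS hE to_rootS mulmxA.
Qed.

End HomToRoot.

Section FlagRep.

Variables (F : finFieldType) (n k : nat) (l : 'I_k -> nat).
Variable m : forall i : 'I_k, 'I_(l i).+1 -> nat.
Arguments m : clear implicits.
Hypothesis sum_m : forall i : 'I_k, (\sum_j m i j = n.+1)%N.

Local Notation leg := (leg_vertex l).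
Local Notation gT := {'GL_n.+1[F]}.
Local Notation d := (star_dim n.+1 m).

Lemma star_dimE (x : leg) :
  d (Some x) = (n.+1 - block_offset (m (tag x)) (tagged x).+1)%N.
Proof. by []. Qed.

Lemma star_dim_le v : (d v <= d None)%N.
Proof. by case: v => [x|] //; rewrite star_dimE leq_subr. Qed.

Lemma star_dim_pred (x : leg) : (d (Some x) <= d (leg_pred x))%N.
Proof.
have dx := depth_leg_pred x; have tx := @tag_leg_pred _ _ x.
move: dx tx; case: (leg_pred x) => [y|] dx tx; last exact: (star_dim_le (Some x)).
have {}tx := tx y erefl.
rewrite !star_dimE leq_sub2l //.
move: x y dx tx => [i a] [i' b] /= ba ii'; case: i / ii' a ba => a ba.
by apply: block_offset_mono; rewrite ltnS -ba.
Qed.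

(** The dimension is [n.+1] by definition only at the central vertex, so [A] acts there and the
    arrows between leg vertices stay standard. *)
Definition root_twist (A : 'M[F]_n.+1) v : 'M[F]_(d v) :=
  match v with None => A | Some _ => 1%:M end.

(* The flags attached to the legs are the standard ones moved by the f i. *)
Definition flag_rep (f : 'I_k -> gT) : rep F d := fun x : leg =>
  last_rows F (d (Some x)) (d (leg_pred x)) *m
  root_twist (GLval ((f (tag x))^-1)%g) (leg_pred x).

Lemma flag_rep_free f (x : leg) : row_free (flag_rep f x).
Proof.
have free v (A : 'M[F]_n.+1) : A \in unitmx -> row_free (root_twist A v).
  by case: v => [y|] uA; rewrite row_free_unit ?unitmx1.
rewrite /flag_rep /row_free mxrankMfree; first exact: last_rows_free (star_dim_pred x).
exact: free (GL_unitmx ((f (tag x))^-1)%g).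
Qed.

Lemma flag_rep_to_rootS f (x : leg) :
  to_root (flag_rep f) (Some x) = last_rows F (d (Some x)) (d (leg_pred x)) *m
  root_twist (GLval ((f (tag x))^-1)%g) (leg_pred x) *m
  to_root (flag_rep f) (leg_pred x).
Proof. exact: to_rootS. Qed.

Lemma flag_rep_to_root f (x : leg) :
  to_root (flag_rep f) (Some x) =
  last_rows F (d (Some x)) (d None) *m GLval ((f (tag x))^-1)%g.
Proof.
suff : forall v, match v as v return 'M[F]_(d v, d None) -> Prop with
    | None => fun R => R = 1%:M
    | Some y => fun R => R = last_rows F (d (Some y)) (d None) *m GLval ((f (tag y))^-1)%g
    end (to_root (flag_rep f) v) by move/(_ (Some x)).
elim/leg_ind => // {}x; rewrite flag_rep_to_rootS.
have tx := @tag_leg_pred _ _ x; have dx := star_dim_pred x.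
move: (to_root _ _) tx dx; case: (leg_pred x) => [y|] R tx dx -> /=.
  rewrite mulmx1 mulmxA mul_last_rows ?(star_dim_le (Some y)) //.
  by rewrite (tx y erefl).
by rewrite mulmx1.
Qed.

Local Notation T := (transporter (fun i => parabolic F (sum_m i))).

(** A step E of the standard flag is moved to E f^-1, and [g] maps it into E f'^-1 exactly if f^-1 g
    f' preserves E. This is the reason for the inverse in [flag_rep]. *)
Lemma rep_hom_transporter f f' (h : dimhom F d d) (g : gT) :
  GLval g = h None -> rep_hom (flag_rep f) (flag_rep f') h ->
  g \in T f f' /\
  forall x : leg, h (Some x) =
    corner (d (Some x)) (GLval ((f (tag x))^-1 * g * f' (tag x))%g).
Proof.
move=> gh hh.
have stab (x : leg) : last_rows F (d (Some x)) (d None) *m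
    GLval ((f (tag x))^-1 * g * f' (tag x))%g =
    h (Some x) *m last_rows F (d (Some x)) (d None).
  have := rep_hom_to_root hh (Some x); rewrite !flag_rep_to_root -gh => E.
  set L := last_rows _ _ _ in E *.
  change (L *m (GLval ((f (tag x))^-1)%g *m GLval g *m GLval (f' (tag x))) = h (Some x) *m L).
  rewrite !mulmxA E -!mulmxA.
  change (h (Some x) *m (L *m GLval ((f' (tag x))^-1 * f' (tag x))%g) = h (Some x) *m L).
  by rewrite mulVg mulmx1.
have hE (x : leg) : h (Some x) =
    corner (d (Some x)) (GLval ((f (tag x))^-1 * g * f' (tag x))%g).
  rewrite /corner stab -mulmxA last_rows_trK ?mulmx1 //.
  exact: (star_dim_le (Some x)).
split=> //; apply/transporterP => i; apply/parabolic_cornerP => j js /=.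
pose x : leg := Tagged (fun i => 'I_(l i)) (Ordinal js).
have := stab x; rewrite hE => {}stab; exact: stab.
Qed.

Lemma transporter_rep_hom f f' g : g \in T f f' ->
  exists h : dimhom F d d,
    h None = GLval g /\ rep_hom (flag_rep f) (flag_rep f') h.
Proof.
move=> /transporterP Tg.
pose h : dimhom F d d := fun v => if v is Some x then
  corner (d (Some x)) (GLval ((f (tag x))^-1 * g * f' (tag x))%g) else GLval g.
exists h; split=> //; apply: to_root_rep_hom => [x|[x|]]; first exact: flag_rep_free.
  rewrite !flag_rep_to_root /h.
  have := parabolic_cornerP _ _ (Tg (tag x)) (tagged x) (ltn_ord _) => /= stab.
  rewrite [RHS]mulmxA -[corner _ _ *m _]stab -[LHS]mulmxA -[RHS]mulmxA.
  congr (_ *m _).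
  change (GLval ((f (tag x))^-1 * g)%g =
    GLval ((f (tag x))^-1 * g * f' (tag x) * (f' (tag x))^-1)%g).
  by rewrite mulgK.
by rewrite mul1mx mulmx1.
Qed.

Lemma flag_rep_isoP f f' :
  rep_iso (flag_rep f) (flag_rep f') <-> exists g, g \in T f f'.
Proof.
split=> [[h [h' [hh' hh]]]|[g Tg]].
  have [h0 h0'] := hh' None; have [uh _] := mulmx1_unit h0.
  pose g : gT := FinRing.unit 'M_n.+1 uh.
  by exists g; have [] := @rep_hom_transporter f f' h g erefl hh.
have [h [hg hh]] := transporter_rep_hom Tg.
have [h' [hg' hh']] : exists h' : dimhom F d d,
    h' None = GLval (g^-1)%g /\ rep_hom (flag_rep f') (flag_rep f) h'.
  by apply: transporter_rep_hom; rewrite transporterV.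
(* An endomorphism of an injective representation is determined by its value at the central
   vertex. *)
have one f1 (u : dimhom F d d) : u None = 1%:M -> rep_hom (flag_rep f1) (flag_rep f1) u ->
    forall v, u v = 1%:M.
  move=> u1 hu v; apply: (row_free_inj (to_root_free v (flag_rep_free f1))).
  by rewrite -(rep_hom_to_root hu) u1 mulmx1 mul1mx.
exists h, h'; split=> // v; split.
  apply: (one f (fun v => h v *m h' v)); last exact: rep_homM hh hh'.
  by rewrite hg hg'; change (GLval (g * g^-1)%g = 1%:M); rewrite mulgV.
apply: (one f' (fun v => h' v *m h v)); last exact: rep_homM hh' hh.
by rewrite hg hg'; change (GLval (g^-1 * g)%g = 1%:M); rewrite mulVg.
Qed.

(** Bases chosen inwards along each leg bring its arrows to the form [last_rows]. At the central
    vertex the legs ask for different bases [Z i]; these become the [f i], and the isomorphism is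
    the identity there. *)
Lemma flag_rep_surj (M : rep F d) : (forall x : leg, row_free (M x)) ->
  exists f : {ffun 'I_k -> gT}, rep_iso M (flag_rep f).
Proof.
move=> freeM.
pose T v := {A : 'M[F]_(d v) | A \in unitmx}.
pose R (x : leg) (t : T (Some x)) (t' : T (leg_pred x)) :=
  M x *m sval t' = sval t *m last_rows F _ _.
have t0 v : T v by exists 1%:M; apply: unitmx1.
have [x [A uA]|G [Z GP]] := @leg_choice _ _ T R t0.
  have [|u uu E] := @row_free_extend _ _ _ (M x) (A *m last_rows F _ (d (leg_pred x))) (freeM x).
    rewrite /row_free mxrankMfree ?last_rows_free ?star_dim_pred //.
    by rewrite -[_ == _]/(row_free A) row_free_unit.
  by exists (exist _ u uu).
have [f fE] : exists f : {ffun 'I_k -> gT}, forall i, GLval (f i) = sval (Z i).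
  by exists [ffun i => FinRing.unit 'M_n.+1 (svalP (Z i)) : gT] => i; rewrite ffunE.
exists f.
pose g : dimhom F d d := fun v => if v is Some x then sval (G x) else 1%:M.
have ug v : g v \in unitmx.
  by case: v => [x|]; rewrite ?unitmx1 //; apply: (svalP (G x)).
exists g, (fun v => invmx (g v)); split=> [v|x]; first by rewrite mulmxV ?mulVmx.
have twist v (A B : 'M[F]_(d (Some x), d v)) :
    A *m sval (match v as v return T v with Some y => G y | None => Z (tag x) end) =
      sval (G x) *m B ->
    A *m g v = sval (G x) *m (B *m root_twist (GLval ((f (tag x))^-1)%g) v).
  rewrite mulmxA; case: v A B => [y|] A B /= <-; first by rewrite mulmx1.
  have zz (z : gT) : GLval z *m GLval (z^-1)%g = 1%:M.
    by change (GLval (z * z^-1)%g = 1%:M); rewrite mulgV.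
  by rewrite -fE -mulmxA zz.
exact: twist (GP x).
Qed.

End FlagRep.

Lemma big_option (R : Type) (idx : R) (op : Monoid.com_law idx) (T : finType)
    (E : option T -> R) :
  \big[op/idx]_(v : option T) E v = op (E None) (\big[op/idx]_(x : T) E (Some x)).
Proof.
rewrite (bigD1 None) //=; congr (op _ _).
rewrite (reindex_omap (@Some T) id) /=; last by case.
by apply: eq_bigl => x; rewrite eqxx.
Qed.

(** * Comparison of the two characters and the final count *)

Section Multiplicity.

Variables (F : finFieldType) (n k : nat) (l : 'I_k -> nat).
Variable m : forall i : 'I_k, 'I_(l i).+1 -> nat.
Arguments m : clear implicits.
Hypothesis sum_m : forall i : 'I_k, (\sum_j m i j = n.+1)%N.
Variable delta : forall i : 'I_k, 'I_(l i).+1 -> 'CF([set: {unit F}]).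
Arguments delta : clear implicits.
Hypothesis delta_lin : forall i j, delta i j \is a linear_char.

Local Notation gT := {'GL_n.+1[F]}.
Local Notation d := (star_dim n.+1 m).
Local Notation chi := (fun v => unit_char (sigma delta v)).
Local Notation P := (fun i => parabolic F (sum_m i)).
Local Notation lam := (fun i => inflated_char (sum_m i) (delta i)).
Local Notation T := (transporter P).

(** Grouped by legs, the factors at the leg vertices are those of [inflated_char_corner]. The factor
    at the central vertex splits over the legs, since det g is unchanged by conjugation with each
    [f i]. *)
Lemma stab_charE (f : 'I_k -> gT) (g : gT) (h : dimhom F d d) : GLval g = h None ->
  rep_hom (flag_rep m f) (flag_rep m f) h -> det_char chi h = stab_char lam f g.
Proof.
move=> gh hh; have [/transporterP Tg hE] := rep_hom_transporter sum_m gh hh.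
rewrite /det_char big_option /= -gh /stab_char.
have detg0 : \det (GLval g) != 0 by apply: GL_det.
pose w : {unit F} := insubd (1%g : {unit F}) (\det (GLval g)).
have wE : val w = \det (GLval g) by rewrite insubdK // unitfE.
have -> : unit_char (\prod_i delta i ord0) (\det (GLval g)) =
    \prod_i unit_char (delta i ord0) (\det (GLval g)).
  rewrite -wE unit_char_val prod_cfunE ?inE //.
  by apply: eq_bigr => i _; rewrite unit_char_val.
pose E i (j : 'I_(l i)) := unit_char (delta i (lift ord0 j) /
    delta i (widen_ord (leqnSn _) j))%R
  (\det (corner (n.+1 - block_offset (m i) j.+1) (GLval ((f i)^-1 * g * f i)%g))).
rewrite (eq_bigr (fun x : leg_vertex l => E (tag x) (tagged x))); last first.
  by move=> x _; rewrite hE.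
have -> : \prod_(x : leg_vertex l) E (tag x) (tagged x) = \prod_i \prod_j E i j.
  by rewrite sig_big_dep.
rewrite -big_split; apply: eq_bigr => i _ /=.
rewrite conjgE mulgA inflated_char_corner //.
congr (unit_char _ _ * _); rewrite !GL_MxE !det_mulmx GL_VxE det_inv mulrAC mulVf ?mul1r //.
exact: GL_det.
Qed.

Lemma stab_trivialP (f : 'I_k -> gT) :
  reflect (aut_trivial chi (flag_rep m f)) (stab_trivial lam f).
Proof.
apply: (iffP forall_inP) => [tr h hh uh|tr g Tg].
  pose g : gT := FinRing.unit 'M_n.+1 (uh None).
  have gh : GLval g = h None by [].
  rewrite (stab_charE gh hh); apply/eqP/tr.
  by have [] := rep_hom_transporter sum_m gh hh.
have [h [hg hh]] := transporter_rep_hom Tg.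
have [h' [hg' hh']] : exists h' : dimhom F d d,
    h' None = GLval (g^-1)%g /\ rep_hom (flag_rep m f) (flag_rep m f) h'.
  by apply: (transporter_rep_hom (sum_m := sum_m)); rewrite transporterV.
rewrite -(stab_charE (esym hg) hh); apply/eqP/tr => // v.
have hh1 : h v *m h' v = 1%:M.
  apply: (row_free_inj (to_root_free v (flag_rep_free m f))).
  rewrite -(rep_hom_to_root (rep_homM hh hh')) hg hg' mul1mx.
  by change (to_root (flag_rep m f) v *m GLval (g * g^-1)%g = to_root (flag_rep m f) v);
    rewrite mulgV mulmx1.
by have [] := mulmx1_unit hh1.
Qed.

End Multiplicity.

Theorem theorem1p3p4
  (F : finFieldType) (n k : nat) (k_gt0 : (0 < k)%N)
  (l : 'I_k -> nat)
  (m : forall i : 'I_k, 'I_(l i).+1 -> nat)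
  (sum_m : forall i : 'I_k, (\sum_j m i j = n.+1)%N)
  (delta : forall i : 'I_k, 'I_(l i).+1 -> 'CF([set: {unit F}]))
  (delta_lin : forall i j, delta i j \is a linear_char)
  (V : dimvec (star l) -> Prop)
  (V_nonincreasing : forall b, V b -> nonincreasing b)
  (level_V : is_of_level delta (star_dim n.+1 m) V)
  (M : {poly int})
  (M_level_poly : is_level_poly (star_dim n.+1 m) V M) :
  '[\prod_(i < k) HC_ind (levi_char (sum_m i) (delta i)), 1]_('GL_n.+1[F])
  = (M.[#|F|%:Z])%:~R.
Proof.
rewrite M_level_poly.
set chi := fun v => unit_char (sigma delta v).
set lam := fun i => inflated_char (sum_m i) (delta i).
have lam_lin i : lam i \is a linear_char by apply: inflated_char_lin.
rewrite [LHS](cfdot_prod_Ind lam_lin).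
set d := star_dim n.+1 m.
rewrite /num_iso_classes.
set R := (fun M N => `[< _ >]); set D := [set _ | _]; set E := equivalence_partition R D.
pose rp := {dffun forall a : arrow (star l), 'M[F]_(d (source a), d (target a))}.
have eqR : {in D & &, equivalence_rel R}.
  move=> x y z _ _ _; split; first by apply/asboolP/rep_iso_refl.
  move=> /asboolP xy; apply/asboolP/asboolP; last exact: rep_iso_trans.
  by apply: rep_iso_trans; apply: rep_iso_sym.
have DE (x : rp) : x \in D = `[< (forall a : leg_vertex l, row_free (x a)) /\ aut_trivial chi (x : rep F d) >].
  rewrite inE; apply: asbool_equiv_eq; exact: level_at_mostP.
have iso_tr d1 d2 (M1 : rep F d1) (M2 : rep F d2) : rep_iso M1 M2 ->
    aut_trivial chi M2 -> aut_trivial chi M1.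
  by move/summand_iso; apply: aut_trivial_summand.
pose S (f : {ffun 'I_k -> {'GL_n.+1[F]}}) : rp := [ffun a => flag_rep m f a].
have SE f : (S f : rep F d) = flag_rep m f.
  by apply/functional_extensionality_dep => a; rewrite /S ffunE.
have SD f : (S f \in D) = stab_trivial lam f.
  rewrite DE SE; apply/asboolP/(stab_trivialP sum_m delta_lin) => [[]//|tr].
  by split=> // a; apply: flag_rep_free.
have partE : partition E D := equivalence_partitionP eqR.
have [/eqP coverE trivE n0E] := and3P partE.
set N := (#|_| * _)%N.
have N_gt0 : (0 < N)%N.
  rewrite muln_gt0 prodn_gt0 ?andbT; last by move=> i; apply: cardG_gt0.
  by apply/card_gt0P; exists 1%g.
(* Every class in [E] receives the same total weight [N] from the tuples [f] that represent it. *)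
suff -> : (\sum_(f : {ffun 'I_k -> {'GL_n.+1[F]}} | stab_trivial lam f)
    #|transporter (fun i => parabolic F (sum_m i)) f f| = #|E| * N)%N.
  by rewrite natrM mulfK // pnatr_eq0 -lt0n.
rewrite (eq_bigl _ _ (fun f => esym (SD f))).
rewrite (partition_big (fun f => pblock E (S f)) (mem E)) /=; last first.
  by move=> f Sf; rewrite pblock_mem // coverE.
rewrite -sum_nat_const; apply: eq_bigr => c Ec.
have [M0 M0c] : exists M0, M0 \in c.
  by apply/set0Pn; apply: contraNneq n0E => <-.
have M0D : M0 \in D by rewrite -coverE; apply/bigcupP; exists c.
have cE : c = pblock E M0 by rewrite (def_pblock trivE Ec M0c).
have /asboolP[free0 tr0] : `[< (forall a : leg_vertex l, row_free (M0 a)) /\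
    aut_trivial chi (M0 : rep F d) >] by rewrite -DE.
have [f0 iso0] := flag_rep_surj free0.
(* The order of the transporter from [f0] to [f] is the weight of [f] if [f] represents [c], and 0
   otherwise. *)
rewrite /N -(sum_card_transporter (fun i => parabolic F (sum_m i)) f0).
rewrite big_mkcond; apply: eq_bigr => f _.
have [T0|/set0Pn[g Tg]] := eqVneq (transporter (fun i => parabolic F (sum_m i)) f0 f) set0.
  rewrite T0 cards0; case: ifP => // /andP[Sf]; rewrite cE eq_sym eq_pblock ?coverE //.
  rewrite pblock_equivalence_partition // => /asboolP; rewrite SE => iso.
  have /(flag_rep_isoP sum_m)[g] := rep_iso_trans (rep_iso_sym iso0) iso.
  by rewrite T0 inE.
have iso : rep_iso (M0 : rep F d) (flag_rep m f).
  by apply: rep_iso_trans iso0 _; apply/(flag_rep_isoP sum_m); exists g.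
have Sf : S f \in D.
  rewrite SD; apply/(stab_trivialP sum_m delta_lin).
  exact: iso_tr (rep_iso_sym iso) tr0.
rewrite Sf cE eq_sym eq_pblock ?coverE // pblock_equivalence_partition //.
rewrite ifT; first by rewrite -(card_transporter Tg).
by apply/asboolP; rewrite SE.
Qed.
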